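(* Let $(R,m,k)$ be a regular local ring and assume that the order ideal conjecture is valid for $R$. Let $I$ be any ideal of $R$ of codimension $d$ and let $\Omega$ denote the canonical module of $R/I$. Then $\operatorname{Syz}^d(\Omega)$ has a free summand.
   Context: ''Local ring'' means Noetherian local ring. For a finitely generated $R$-module $M$, $\operatorname{Syz}^i(M)$ is its $i$-th syzygy in a minimal free resolution $F_\bullet$ over $R$, i.e. the image of $F_i\to F_{i-1}$ for $i\ge1$ ($\operatorname{Syz}^0(M)=M$). The order ideal conjecture for a local ring $R$ is the assertion: for every finitely generated $R$-module $M$ of finite projective dimension, every $i>0$ and every minimal generator $\beta$ of $\operatorname{Syz}^i(M)$, the order ideal $\mathcal{O}_{\operatorname{Syz}^i(M)}(\beta)=\{f(\beta)\mid f\in\operatorname{Hom}_R(\operatorname{Syz}^i(M),R)\}$ has grade $\ge i$ (the unit ideal has grade $\infty$). Codimension of $I$ means height of $I$. The canonical module of $R/I$, for $I$ of height $d$, is $\Omega=\operatorname{Ext}^d_R(R/I,R)$. ''Has a free summand'' means has a direct summand isomorphic to $R$. *)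

(* Defs.v *)
From HB Require Import structures.
From mathcomp Require Import all_boot all_order all_algebra.
From mathcomp Require Import generic_quotient ring_quotient boolp.

Set Implicit Arguments.
Unset Strict Implicit.
Unset Printing Implicit Defensive.

Import GRing.Theory.
Local Open Scope ring_scope.
Local Open Scope quotient_scope.

(* An ideal of the commutative ring R is an R-submodule of R; it need not be
   proper, whereas [idealr R] of ring_quotient only contains proper ideals. *)
Notation ideal R := (submodClosed R^o).

Section Modules.
Variable R : comNzRingType.

Record submod (V : lmodType R) (S : submodClosed V) :=
  SubMod { submod_val : V; _ : submod_val \in S }.

HB.instance Definition _ V S := [isSub for @submod_val V S].
HB.instance Definition _ V S := [Choice of @submod V S by <:].
HB.instance Definition _ V S := [SubChoice_isSubLmodule of @submod V S by <:].

Section Quotient.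
Variables (V : lmodType R) (S : submodClosed V).

(* [Quotient.quot] needs closure under opposite, which [submodClosed] provides only
   through [submodClosedP]; hence this copy of S. *)
Definition submod_zmod : {pred V} := S.

Fact submod_zmod_closed : zmod_closed submod_zmod.
Proof. exact: GRing.submod_closedB (submodClosedP S). Qed.

HB.instance Definition _ :=
  GRing.isZmodClosed.Build V submod_zmod submod_zmod_closed.

Definition quotmod := Quotient.quot submod_zmod.

HB.instance Definition _ := GRing.Zmodule.on quotmod.
HB.instance Definition _ : EqQuotient V (Quotient.equiv submod_zmod) quotmod :=
  EqQuotient.on quotmod.

Definition quotmod_scale (a : R) (x : quotmod) : quotmod :=
  \pi_quotmod (a *: repr x).

Fact pi_quotmodE (x y : V) :
  (\pi_quotmod x = \pi_quotmod y) <-> (x - y \in S).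
Proof.
by split=> [/eqP|xyS]; last apply/eqP;
  rewrite -(@Quotient.idealrBE V submod_zmod x y).
Qed.

Fact pi_quotmodZ (a : R) (x : V) :
  quotmod_scale a (\pi_quotmod x) = \pi_quotmod (a *: x).
Proof.
apply/pi_quotmodE; rewrite -scalerBr; apply: rpredZ.
by apply/pi_quotmodE; rewrite reprK.
Qed.

Fact pi_quotmodD (x y : V) :
  \pi_quotmod x + \pi_quotmod y = \pi_quotmod (x + y).
Proof. by symmetry; exact: (Quotient.pi_add submod_zmod x y). Qed.

Fact quotmod_scaleA a b v :
  quotmod_scale a (quotmod_scale b v) = quotmod_scale (a * b) v.
Proof. by rewrite -[v]reprK (pi_quotmodZ b) !pi_quotmodZ scalerA. Qed.

Fact quotmod_scale1 : left_id 1 quotmod_scale.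
Proof. by move=> v; rewrite -[v]reprK pi_quotmodZ scale1r. Qed.

Fact quotmod_scaleDr : right_distributive quotmod_scale +%R.
Proof.
move=> a u v; rewrite -[u]reprK -[v]reprK pi_quotmodD !pi_quotmodZ.
by rewrite pi_quotmodD scalerDr.
Qed.

Fact quotmod_scaleDl v :
  {morph quotmod_scale^~ v : a b / a + b}.
Proof.
by move=> a b; rewrite -[v]reprK !pi_quotmodZ pi_quotmodD scalerDl.
Qed.

HB.instance Definition _ := GRing.Zmodule_isLmodule.Build R quotmod
  quotmod_scaleA quotmod_scale1 quotmod_scaleDr quotmod_scaleDl.

End Quotient.

Section Image.
Variables (U V : lmodType R) (f : {linear U -> V}).

Definition im_lin : {pred V} := fun v => `[< exists u, f u = v >].

Fact im_lin_closed : submod_closed im_lin.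
Proof.
split=> [|a u v]; first by apply/asboolP; exists 0; rewrite linear0.
move=> /asboolP[x <-] /asboolP[y <-]; apply/asboolP.
by exists (a *: x + y); rewrite linearP.
Qed.

HB.instance Definition _ := GRing.isSubmodClosed.Build R V im_lin im_lin_closed.

End Image.

Definition lmod_iso (U V : lmodType R) : Prop :=
  exists f : {linear U -> V}, bijective f.

Definition has_free_summand (N : lmodType R) : Prop :=
  exists N' : lmodType R, lmod_iso N (R^o * N')%type.

Definition in_span (M : lmodType R) (s : seq M) (x : M) : Prop :=
  exists c : 'I_(size s) -> R, x = \sum_i c i *: s`_i.

Definition generates (M : lmodType R) (s : seq M) : Prop :=
  forall x, in_span s x.

Definition finitely_generated (M : lmodType R) : Prop :=
  exists s : seq M, generates s.

(* No proper subfamily of s generates M. *)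
Definition minimal_generating (M : lmodType R) (s : seq M) : Prop :=
  generates s /\ forall t, subseq t s -> generates t -> t = s.

Definition minimal_generator (M : lmodType R) (b : M) : Prop :=
  exists2 s, minimal_generating s & b \in s.

Definition projective (P : lmodType R) : Prop :=
  forall (U V : lmodType R) (g : {linear U -> V}) (f : {linear P -> V}),
    (forall v, exists u, g u = v) ->
    exists h : {linear P -> U}, forall x, g (h x) = f x.

Definition is_resolution (M : lmodType R) (P : nat -> lmodType R)
    (d : forall i, {linear P i.+1 -> P i}) (e : {linear P 0 -> M}) : Prop :=
  [/\ forall x, exists y, e y = x,
      forall x, e x = 0 <-> exists y, d 0 y = x
    & forall i x, d i x = 0 <-> exists y, d i.+1 y = x].

Definition finite_projdim (M : lmodType R) : Prop :=
  exists (P : nat -> lmodType R) (d : forall i, {linear P i.+1 -> P i})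
         (e : {linear P 0 -> M}) (n : nat),
    [/\ is_resolution d e, forall i, projective (P i)
      & forall i, (n < i)%N -> forall x : P i, x = 0].

Record free_resolution (M : lmodType R) := FreeResolution {
  rk : nat -> nat;
  bd : forall i, {linear 'rV[R]_(rk i.+1) -> 'rV[R]_(rk i)};
  aug : {linear 'rV[R]_(rk 0) -> M};
  _ : @is_resolution M (fun i => 'rV[R]_(rk i)) bd aug
}.

(* The image of F_(i+1) lies in m F_i, that is, in the row vectors with all
   entries in m. *)
Definition minimal (m : ideal R) (M : lmodType R) (F : free_resolution M) :=
  forall i y j, bd F i y 0 j \in m.

(* [bd F j] is the map F_(j+1) -> F_j. *)
Definition syz (M : lmodType R) (F : free_resolution M) (i : nat)
    : lmodType R :=
  if i is j.+1 then submod (im_lin (bd F j)) else M.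

Section Ext.
(* Ext^i_R(M, R) as the cohomology of Hom_R(F, R). *)
Variables (M : lmodType R) (F : free_resolution M).

Definition cocycle i : {pred 'Hom('rV[R]_(rk F i), R^o)} :=
  fun phi => `[< forall x, phi (bd F i x) = 0 >].

Fact cocycle_closed i : submod_closed (@cocycle i).
Proof.
split=> [|a f g]; first by apply/asboolP=> x; rewrite lfunE.
move=> /asboolP f0 /asboolP g0; apply/asboolP=> x.
by rewrite add_lfunE scale_lfunE f0 g0 scaler0 addr0.
Qed.

HB.instance Definition _ i :=
  GRing.isSubmodClosed.Build R _ (@cocycle i) (@cocycle_closed i).

Definition is_coboundary i : 'Hom('rV[R]_(rk F i), R^o) -> Prop :=
  match i with
  | 0 => fun phi => phi = 0
  | j.+1 => fun phi =>
      exists psi : 'Hom('rV[R]_(rk F j), R^o), forall x, phi x = psi (bd F j x)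
  end.

Definition coboundary i : {pred submod (@cocycle i)} :=
  fun z => `[< is_coboundary (val z) >].

Fact coboundary_closed i : submod_closed (@coboundary i).
Proof.
split=> [|a u v].
  apply/asboolP; rewrite raddf0; case: i => [//|j] /=.
  by exists 0 => x; rewrite !lfunE.
move=> /asboolP fu /asboolP fv; apply/asboolP; rewrite linearP.
case: i u v fu fv => [|j] u v /=; first by move=> -> ->; rewrite scaler0 addr0.
move=> [f fu] [g gv]; exists (a *: f + g) => x.
by rewrite !add_lfunE !scale_lfunE fu gv.
Qed.

HB.instance Definition _ i :=
  GRing.isSubmodClosed.Build R _ (@coboundary i) (@coboundary_closed i).

Definition ext i : lmodType R := quotmod (@coboundary i).

End Ext.

(* E is isomorphic to Ext^i_R(M, R). Up to isomorphism, the choice of the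
   resolution by free modules of finite rank does not matter. *)
Definition is_ext (i : nat) (M E : lmodType R) : Prop :=
  exists F : free_resolution M, lmod_iso E (ext F i).

Definition order_ideal (N : lmodType R) (b : N) : {pred R^o} :=
  fun a => `[< exists f : {linear N -> R^o}, f b = a >].

Fact order_ideal_closed N b : submod_closed (@order_ideal N b).
Proof.
split=> [|a u v]; first by apply/asboolP; exists \0.
move=> /asboolP[f <-] /asboolP[g <-]; apply/asboolP.
by exists (a \*: f \+ g).
Qed.

HB.instance Definition _ N b :=
  GRing.isSubmodClosed.Build R R^o (@order_ideal N b) (@order_ideal_closed N b).

Definition regular_sequence (s : seq R^o) : Prop :=
  (forall i, (i < size s)%N -> forall x : R^o,
     in_span (take i s) (s`_i * x) -> in_span (take i s) x)
  /\ ~ in_span s 1.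

(* grade J >= i, the unit ideal having infinite grade. *)
Definition grade_ge (J : ideal R) (i : nat) : Prop :=
  (1 : R) \in J \/
  exists s : seq R^o, [/\ size s = i, {subset s <= J} & regular_sequence s].

Definition prime_ideal (P : ideal R) : Prop :=
  (1 : R) \notin P /\ @prime_idealr_closed R P.

Definition maximal_ideal (m : ideal R) : Prop :=
  (1 : R) \notin m /\
  forall J : ideal R, (1 : R) \notin J ->
    {subset m <= J} -> {subset J <= m}.

(* c 0 < c 1 < ... < c n, strictly increasing prime ideals. *)
Definition prime_chain (n : nat) (c : nat -> ideal R) : Prop :=
  (forall i, (i <= n)%N -> prime_ideal (c i)) /\
  (forall i, (i < n)%N ->
     {subset c i <= c i.+1} /\ ~ {subset c i.+1 <= c i}).

Definition krull_dim_ge (n : nat) : Prop := exists c, prime_chain n c.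

Definition krull_dim (n : nat) : Prop :=
  krull_dim_ge n /\ ~ krull_dim_ge n.+1.

Definition prime_height_ge (P : ideal R) (n : nat) : Prop :=
  exists2 c, prime_chain n c & c n =i P.

(* The height of I is the infimum of the heights of the primes containing I
   (infinite for the unit ideal). *)
Definition height_ge (I : ideal R) (n : nat) : Prop :=
  forall P : ideal R, prime_ideal P -> {subset I <= P} -> prime_height_ge P n.

Definition height (I : ideal R) (n : nat) : Prop :=
  height_ge I n /\ ~ height_ge I n.+1.

Definition noetherian : Prop :=
  forall J : ideal R, finitely_generated (submod J).

Definition local_ring (m : ideal R) : Prop :=
  [/\ noetherian, maximal_ideal m & forall J, maximal_ideal J -> J =i m].

(* m is generated by dim R elements. *)
Definition regular_local_ring (m : ideal R) : Prop :=
  local_ring m /\ exists2 s : seq (submod m), generates s & krull_dim (size s).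

Definition order_ideal_conjecture (m : ideal R) : Prop :=
  forall (M : lmodType R), finitely_generated M -> finite_projdim M ->
  forall (F : free_resolution M), minimal m F ->
  forall (i : nat), (0 < i)%N ->
  forall b : syz F i, minimal_generator b -> grade_ge (order_ideal b) i.

End Modules.

(* Main.v *)
(** Let F resolve R/I and L resolve Omega = Ext^d(R/I, R). Regular local rings are
    Cohen-Macaulay, so grade I = d and Ext^i(R/I, R) = Ext^i(Omega, R) = 0 for
    i < d. Hence the dual of F is exact in degrees < d, and the horseshoe lemma
    applied to the d-cocycles, an extension of Omega by the d-coboundaries,
    presents the (d+1)-st syzygy Z of W = coker (D_d -> D_(d+1)) as an extension
    of Syz^(d-1)(Omega) by D_0, where D_i = Hom(F_i, R). Comparing it with
    L_(d-1) -> Syz^(d-1)(Omega) gives a map Syz^d(Omega) -> D_0; let chi be its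
    value at e0 in F_0, where e0 maps to 1 in R/I. If chi takes no unit value, the
    lift lam in D_0 of the augmentation of F is not in m Z, so by the order
    ideal conjecture for W its order ideal in Z has grade at least d+1. But this
    ideal annihilates Omega: the class of Z in Ext^1(Syz^(d-1)(Omega), D_0)
    is the image of the inclusion of Omega under injective connecting maps.
    Therefore Ext^d(Omega, R) = 0, Z splits, Omega = 0 and grade I > d, which is
    absurd. So chi is surjective and splits off R.

    The Cohen-Macaulay property is obtained from Krull's principal ideal theorem
    (the generators of m form a regular sequence) and the bound
    dim R/P >= depth R/J for P associated to R/J. *)

From HB Require Import structures.
Require Import Defs.
From mathcomp Require Import all_boot all_order all_algebra.
From mathcomp Require Import generic_quotient ring_quotient boolp.
From mathcomp Require Import ring zify.

Set Implicit Arguments.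
Unset Strict Implicit.
Unset Printing Implicit Defensive.

Import GRing.Theory VectorInternalTheory.
Local Open Scope ring_scope.
Local Open Scope quotient_scope.

(** * Submodules and Noetherian rings *)

Section Submodules.
Variable R : comNzRingType.

(** The passage to $W$ gains one degree: [lam] becomes an element of a syzygy of order $d+1$, and a
    regular sequence of length $d+1$ killing $\Omega$ forces $\operatorname{Ext}^d(\Omega,R)=0$,
    which length $d$ would not. The conjecture speaks of minimal resolutions, whereas $Z$ comes out
    of the horseshoe lemma. It is therefore first carried over to arbitrary syzygies, which agree
    with minimal ones up to maps through free modules. It applies to $W$ because Hilbert's syzygy
    theorem bounds its projective dimension. That the order ideal kills $\Omega$ reflects the
    commutativity of $R/I$: by biduality a functional takes at [lam] the value $\lambda(f)$ for some
    $f\in F_0$, and $\lambda(f)v-\lambda(v)f$ lies in the kernel of the augmentation. Ext and Tor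
    with coefficients in $R/J$ are conditions on a resolution, read modulo $J$; explicit lifts and
    homotopies replace the long exact sequences. The case $d=0$ is apart: $R$ is a domain, so $I=0$
    and $\Omega\cong R$ is its own zeroth syzygy. *)

Lemma linear_fun (U V : lmodType R) (f : U -> V) :
  linear f -> exists g : {linear U -> V}, g =1 f.
Proof.
move=> fl.
pose fm := GRing.isLinear.Build R U V *:%R f fl.
by exists (HB.pack_for {linear U -> V} f fm).
Qed.

Definition is_sub (V : lmodType R) (A : V -> Prop) : Prop :=
  A 0 /\ forall a x y, A x -> A y -> A (a *: x + y).

Lemma is_subD (V : lmodType R) (A : V -> Prop) x y :
  is_sub A -> A x -> A y -> A (x + y).
Proof. by move=> [_ h] Ax Ay; rewrite -[x]scale1r; apply: h. Qed.

Lemma is_subZ (V : lmodType R) (A : V -> Prop) a x :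
  is_sub A -> A x -> A (a *: x).
Proof. by move=> [h0 h] Ax; rewrite -[_ *: _]addr0; apply: h. Qed.

Lemma is_subN (V : lmodType R) (A : V -> Prop) x : is_sub A -> A x -> A (- x).
Proof. by move=> h Ax; rewrite -scaleN1r; apply: is_subZ. Qed.

Lemma is_subB (V : lmodType R) (A : V -> Prop) x y :
  is_sub A -> A x -> A y -> A (x - y).
Proof. by move=> h Ax Ay; apply: is_subD => //; apply: is_subN. Qed.

Lemma is_sub_sum (V : lmodType R) (A : V -> Prop) (I : Type) (r : seq I)
    (P : pred I) (F : I -> V) :
  is_sub A -> (forall i, P i -> A (F i)) -> A (\sum_(i <- r | P i) F i).
Proof.
move=> h hF; apply: (big_ind A); [by case: h | | exact: hF].
by move=> x y; apply: is_subD.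
Qed.

Lemma is_sub_mem (V : lmodType R) (S : submodClosed V) : is_sub (fun x => x \in S).
Proof.
split; first exact: rpred0.
by move=> a x y xS yS; apply: rpredD => //; apply: rpredZ.
Qed.

Lemma sub_exists (V : lmodType R) (A : V -> Prop) :
  is_sub A -> exists S : submodClosed V, forall x, (x \in S) = `[< A x >].
Proof.
move=> [h0 h].
pose S : {pred V} := fun x => `[< A x >].
have SC : submod_closed S.
  split; first by apply/asboolP.
  by move=> a x y /asboolP Ax /asboolP Ay; apply/asboolP; apply: h.
pose fm := GRing.isSubmodClosed.Build R V S SC.
by exists (HB.pack_for (submodClosed V) S fm).
Qed.

Definition incl (V : lmodType R) (S : submodClosed V) : {linear submod S -> V} :=
  locked (\val : {linear submod S -> V}).

Lemma inclE (V : lmodType R) (S : submodClosed V) x : incl S x = val x.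
Proof. by rewrite /incl -lock. Qed.

Lemma incl_inj (V : lmodType R) (S : submodClosed V) : injective (incl S).
Proof. by move=> x y; rewrite !inclE; apply: val_inj. Qed.

Lemma incl_mem (V : lmodType R) (S : submodClosed V) x : incl S x \in S.
Proof. by rewrite inclE; apply: valP. Qed.

Lemma incl_onto (V : lmodType R) (S : submodClosed V) x :
  x \in S -> exists y, incl S y = x.
Proof. by move=> xS; exists (SubMod xS); rewrite inclE. Qed.

(** Recursive counterpart of [in_span]: inductions split off one generator with its coefficient
    instead of reindexing a sum. *)
Fixpoint lspan (V : lmodType R) (s : seq V) (x : V) : Prop :=
  if s is g :: s' then exists c, lspan s' (x - c *: g) else x = 0.

Lemma lspan_sub (V : lmodType R) (s : seq V) : is_sub (lspan s).
Proof.
elim: s => [|g s [h0 h]]; first by split=> // a x y -> ->; rewrite scaler0 addr0.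
split; first by exists 0; rewrite scale0r subr0.
move=> a x y [c xc] [c' yc']; exists (a * c + c').
rewrite scalerDl opprD addrACA -scalerA -scalerBr; exact: h.
Qed.

Lemma lspan_mem (V : lmodType R) (s : seq V) x : x \in s -> lspan s x.
Proof.
elim: s => // g s IH; rewrite inE => /orP[/eqP->|/IH xs].
  by exists 1; rewrite scale1r subrr; case: (lspan_sub s).
by exists 0; rewrite scale0r subr0.
Qed.

Lemma lspan_min (V : lmodType R) (s : seq V) (A : V -> Prop) x :
  is_sub A -> (forall y, y \in s -> A y) -> lspan s x -> A x.
Proof.
move=> hA; elim: s x => [|g s IH] x sA /=; first by move=> ->; case: hA.
move=> [c /IH h]; rewrite -[x](subrK (c *: g)); apply: is_subD => //.
  by apply: h => y ys; apply: sA; rewrite inE ys orbT.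
by apply: is_subZ => //; apply: sA; rewrite mem_head.
Qed.

Lemma in_spanE (V : lmodType R) (s : seq V) x : in_span s x <-> lspan s x.
Proof.
split=> [[c ->]|].
  apply: is_sub_sum; first exact: lspan_sub.
  by move=> i _; apply: is_subZ; [exact: lspan_sub | apply/lspan_mem/mem_nth].
elim: s x => [|g s IH] x /=.
  by move=> ->; exists (fun=> 0); rewrite big_ord0.
move=> [c /IH[c' xc]].
exists (fun i => oapp c' c (unlift ord0 i)).
rewrite big_ord_recl unlift_none /=.
under eq_bigr do rewrite liftK /=.
by rewrite -xc addrC subrK.
Qed.

Lemma lspan_cat (V : lmodType R) (s t : seq V) x :
  lspan (s ++ t) x <-> exists2 y, lspan s y & lspan t (x - y).
Proof.
elim: s x => [|g s IH] x /=.
  by split=> [xt|[_ -> //]]; [exists 0; rewrite ?subr0 | rewrite subr0].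
split=> [[c /IH[y ys yt]]|[y [c ys] yt]].
  exists (y + c *: g); first by exists c; rewrite addrK.
  by rewrite opprD addrA addrAC.
exists c; apply/IH; exists (y - c *: g) => //.
by rewrite opprB addrA subrK.
Qed.

(* The elements of A + P s. *)
Fixpoint lin (V : lmodType R) (P : R -> Prop) (A : V -> Prop) (s : seq V) (x : V)
    : Prop :=
  if s is g :: s' then exists2 c, P c & lin P A s' (x - c *: g) else A x.

Definition is_id (A : R -> Prop) : Prop := is_sub (A : R^o -> Prop).

Lemma is_idD A x y : is_id A -> A x -> A y -> A (x + y).
Proof. by move=> h; apply: (is_subD h). Qed.
Lemma is_idN A x : is_id A -> A x -> A (- x).
Proof. by move=> h; apply: (is_subN h). Qed.
Lemma is_idB A x y : is_id A -> A x -> A y -> A (x - y).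
Proof. by move=> h; apply: (is_subB h). Qed.
Lemma is_idMl A a x : is_id A -> A x -> A (a * x).
Proof. by move=> h; apply: (is_subZ a h). Qed.
Lemma is_idMr A a x : is_id A -> A x -> A (x * a).
Proof. by move=> h; rewrite mulrC; apply: (is_subZ a h). Qed.

Lemma is_id_mem (J : ideal R) : is_id (fun x : R => x \in J).
Proof. exact: is_sub_mem. Qed.

Definition is_prime (P : R -> Prop) : Prop :=
  [/\ is_id P, ~ P 1 & forall a b, P (a * b) -> P a \/ P b].

Lemma lin_sub (V : lmodType R) P (A : V -> Prop) s :
  is_id P -> is_sub A -> is_sub (lin P A s).
Proof.
move=> hP hA; elim: s => //= g s [h0 h]; split.
  by exists 0; [case: hP | rewrite scale0r subr0].
move=> a x y [c Pc xc] [c' Pc' yc']; exists (a * c + c').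
  by apply: is_idD => //; apply: is_idMl.
rewrite scalerDl opprD addrACA -scalerA -scalerBr; exact: h.
Qed.

Lemma lin_base (V : lmodType R) (P : R -> Prop) (A : V -> Prop) s x :
  is_id P -> A x -> lin P A s x.
Proof.
move=> hP; elim: s => //= g s IH Ax; exists 0; first by case: hP.
by rewrite scale0r subr0; apply: IH.
Qed.

Lemma lin_scale (V : lmodType R) (P : R -> Prop) (A : V -> Prop) s c x :
  is_id P -> is_sub A -> P c -> lspan s x -> lin P A s (c *: x).
Proof.
move=> hP hA Pc; elim: s x => [|g s IH] x /=.
  by move=> ->; rewrite scaler0; case: hA.
move=> [a xa]; exists (c * a); first exact: is_idMr.
by rewrite -scalerA -scalerBr; apply: IH.
Qed.

Lemma lin_min (V : lmodType R) (P : R -> Prop) (A C : V -> Prop) s x :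
  is_sub C -> (forall y, A y -> C y) ->
  (forall c y, P c -> y \in s -> C (c *: y)) -> lin P A s x -> C x.
Proof.
move=> hC sAC; elim: s x => [|g s IH] x sC /=; first exact: sAC.
move=> [c Pc /IH h]; rewrite -[x](subrK (c *: g)); apply: is_subD => //.
  by apply: h => b y Pb ys; apply: sC => //; rewrite inE ys orbT.
by apply: sC => //; rewrite mem_head.
Qed.

(* Nakayama's lemma for the localisation at P of the module spanned by s. *)
Lemma nakayama (V : lmodType R) P (A : V -> Prop) s :
  is_prime P -> is_sub A ->
  (forall y, y \in s -> exists2 t, ~ P t & lin P A s (t *: y)) ->
  exists2 t, ~ P t & forall y, lspan s y -> A (t *: y).
Proof.
move=> [hP P1 Pp] hA.
suff: (forall y, y \in s -> exists2 t, ~ P t & lin P A s (t *: y)) ->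
  exists2 t, ~ P t & forall y, y \in s -> A (t *: y).
  move=> h /h[t Pt sA]; exists t => // y; apply: lspan_min sA.
  split; first by rewrite scaler0; case: hA.
  move=> a x z Ax Az; rewrite scalerDr scalerA mulrC -scalerA; by apply hA.
elim: s => [|g s IH] H; first by exists 1.
have [t Pt [c Pc gc]] := H g (mem_head _ _).
have hl : is_sub (lin P A s) by apply: lin_sub.
(* In the localisation at [P], [t - c] is a unit, so the relation for [g] can be solved for [g],
   which is then eliminated from the others. *)
have Pu : ~ P (t - c).
  by move=> Ptc; apply: Pt; rewrite -[t](subrK c); apply: is_idD.
have gu : lin P A s ((t - c) *: g) by rewrite scalerBl.
have [|t2 Pt2 sA] := IH.
  move=> y ys; have [|t' Pt' [c' Pc' yc']] := H y; first by rewrite inE ys orbT.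
  exists ((t - c) * t'); first by case/Pp.
  rewrite -scalerA -[t' *: y](subrK (c' *: g)) scalerDr.
  apply: is_subD => //; first exact: is_subZ.
  by rewrite scalerA mulrC -scalerA; apply: is_subZ.
exists (t2 * (t - c)); first by case/Pp.
move=> y; rewrite inE => /orP[/eqP->|ys]; last first.
  by rewrite mulrC -scalerA; apply: is_subZ => //; apply: sA.
rewrite -scalerA.
apply: (@lin_min _ P A (fun x => A (t2 *: x)) s) gu.
- split; first by rewrite scaler0; case: hA.
  by move=> a x z Ax Az; rewrite scalerDr scalerA mulrC -scalerA; apply hA.
- by move=> z Az; apply: is_subZ.
- move=> b z Pb zs; rewrite scalerA mulrC -scalerA; apply: is_subZ => //; exact: sA.
Qed.

End Submodules.

Section Noetherian.
Variable R : comNzRingType.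
Hypothesis noethR : noetherian R.

Lemma noeth_fg (A : R -> Prop) : is_id A ->
  exists s : seq R^o, (forall y, y \in s -> A y) /\ forall x, A x -> lspan s x.
Proof.
move=> hA; have [J JE] := sub_exists (hA : is_sub (A : R^o -> Prop)).
have [s sg] := noethR J; exists (map (incl J) s); split.
  by move=> y /mapP[z _ ->]; apply/asboolP; rewrite -JE; exact: incl_mem.
move=> x Ax; have [|y yx] := @incl_onto _ _ J x; first by rewrite JE; apply/asboolP.
have [c yc] := sg y.
rewrite -yx yc linear_sum; apply: is_sub_sum; first exact: lspan_sub.
move=> i _; rewrite linearZ; apply: is_subZ; first exact: lspan_sub.
by apply/lspan_mem/map_f/mem_nth.
Qed.

(** Failing this, choice yields a strictly ascending sequence of ideals; finitely many generators of
    its union already lie in one member, where the sequence must stop. *)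
Lemma noeth_max (Phi : (R -> Prop) -> Prop) :
  (exists2 A, is_id A & Phi A) ->
  exists A, [/\ is_id A, Phi A & forall B, is_id B -> Phi B ->
     (forall x, A x -> B x) -> forall x, B x -> A x].
Proof.
move=> [A0 hA0 PA0]; apply: contrapT => noA.
have step (A : {A | is_id A /\ Phi A}) : {B : {A | is_id A /\ Phi A} |
    (forall x, sval A x -> sval B x) /\ ~ (forall x, sval B x -> sval A x)}.
  apply: cid; case: A => A [hA PA]; apply: contrapT => noB; apply: noA; exists A.
  split=> // B hB PB AB; apply: contrapT => BA; apply: noB.
  by exists (exist _ B (conj hB PB)).
pose c n := iter n (fun A => sval (step A)) (exist _ A0 (conj hA0 PA0)).
have cS n x : sval (c n) x -> sval (c n.+1) x by apply: (svalP (step (c n))).1.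
have cle n k x : sval (c n) x -> sval (c (k + n)%N) x.
  by elim: k => // k IH /IH; rewrite addSn; apply: cS.
have cid n : is_id (sval (c n)) by case: (svalP (c n)).
pose U x := exists n, sval (c n) x.
have hU : is_id U.
  split; first by exists 0%N; case: (cid 0%N).
  move=> a x y [n nx] [k ky]; exists (n + k)%N; have [_ h] := cid (n + k)%N.
  by apply: h; [rewrite addnC|]; apply: cle.
have [s [sU Us]] := noeth_fg hU.
have [n sn] : exists n, forall y, y \in s -> sval (c n) y.
  elim: s sU {Us} => [|g s IH] sU; first by exists 0%N.
  have [|n sn] := IH; first by move=> y ys; apply: sU; rewrite inE ys orbT.
  have [k gk] := sU g (mem_head _ _); exists (n + k)%N => y.
  rewrite inE => /orP[/eqP->|/sn ny]; first exact: cle.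
  by rewrite addnC; apply: cle.
have [_] := svalP (step (c n)); apply=> x xn1; apply: (lspan_min _ sn); first exact: cid.
by apply: Us; exists n.+1.
Qed.

(** Induction on [s]: the coefficients at [g] of elements of [A] form an ideal. Lifts of its
    generators, together with generators of the part of [A] in the span of the remaining list,
    generate [A]. *)
Lemma noeth_sub_fg (V : lmodType R) (s : seq V) (A : V -> Prop) :
  is_sub A -> (forall x, A x -> lspan s x) ->
  exists t : seq V, (forall y, y \in t -> A y) /\ forall x, A x -> lspan t x.
Proof.
elim: s A => [|g s IH] A hA As; first by exists [::].
pose C (c : R) := exists2 x, A x & lspan s (x - c *: g).
have hC : is_id C.
  split; first by exists 0; [case: hA | rewrite scale0r subr0; case: (lspan_sub s)].
  move=> a b c [x Ax xb] [y Ay yc]; exists (a *: x + y); first by apply hA.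
  rewrite scalerDl opprD addrACA -scalerA -scalerBr.
  by have [_ h] := lspan_sub s; apply: h.
have [cs [csC Ccs]] := noeth_fg hC.
have [xs xsA xsC] : exists2 xs : seq V, (forall y, y \in xs -> A y) &
    forall c, lspan cs c -> exists2 x, lspan xs x & lspan s (x - c *: g).
  elim: cs csC {Ccs} => [|c cs IHc] csC.
    exists [::] => // c /= ->; exists 0 => //; rewrite scale0r subr0.
    by case: (lspan_sub s).
  have [|xs xsA xsC] := IHc; first by move=> y ys; apply: csC; rewrite inE ys orbT.
  have [x0 Ax0 x0c] := csC c (mem_head _ _).
  exists (x0 :: xs) => [y|b /= [a /xsC[x xxs xb]]].
    by rewrite inE => /orP[/eqP->//|]; apply: xsA.
  exists (x + a *: x0); first by exists a; rewrite addrK.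
  have -> : x + a *: x0 - b *: g = (x - (b - a *: c) *: g) + a *: (x0 - c *: g).
    rewrite scalerBl scalerBr scalerA opprB addrACA; congr (_ + _).
    by rewrite addrAC subrr sub0r.
  by apply: is_subD; [exact: lspan_sub | | apply: is_subZ => //; exact: lspan_sub].
have [|x [Ax xs']|t [tA At]] := IH (fun x => A x /\ lspan s x).
- split; first by split; [case: hA | case: (lspan_sub s)].
  move=> a x y [Ax sx] [Ay sy]; split; first by apply hA.
  by have [_ h] := lspan_sub s; apply: h.
- by [].
exists (xs ++ t); split.
  by move=> y; rewrite mem_cat => /orP[/xsA|/tA[]].
move=> x Ax; have /= [c xc] := As x Ax.
have [|y yxs ys] := xsC c; first by apply: Ccs; exists x.
apply/lspan_cat; exists y => //; apply: At; split.
  by apply: is_subB => //; apply: lspan_min yxs.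
have -> : x - y = (x - c *: g) - (y - c *: g) by rewrite opprB addrA subrK.
by apply: is_subB => //; exact: lspan_sub.
Qed.

End Noetherian.

(** * Prime ideals and regular sequences *)

Section Primes.
Variable R : comNzRingType.
Hypothesis noethR : noetherian R.
Implicit Types J A P Q : R -> Prop.

(** Quotient rings are avoided: $R/J$ is represented by $J$ itself, and [nzd J x] says that [x] is a
    nonzerodivisor on $R/J$. *)
Definition idadd J x : R -> Prop := fun a => exists r, J (a - r * x).
Definition colon J w : R -> Prop := fun a => J (a * w).
Definition nzd J x : Prop := forall a, J (x * a) -> J a.

Lemma idadd_id J x : is_id J -> is_id (idadd J x).
Proof.
move=> hJ; split; first by exists 0; rewrite mul0r subr0; case: hJ.
move=> a b c [r br] [s cs]; exists (a * r + s); rewrite /GRing.scale /=.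
have -> : a * b + c - (a * r + s) * x = a * (b - r * x) + (c - s * x) by ring.
by case: hJ => _; apply.
Qed.

Lemma idadd_sub J x a : J a -> idadd J x a.
Proof. by move=> Ja; exists 0; rewrite mul0r subr0. Qed.

Lemma idadd_mem J x : is_id J -> idadd J x x.
Proof. by move=> hJ; exists 1; rewrite mul1r subrr; case: hJ. Qed.

Lemma idadd_min J x A a : is_id A -> (forall b, J b -> A b) -> A x -> idadd J x a -> A a.
Proof.
move=> hA JA Ax [r /JA h]; rewrite -[a](subrK (r * x)); apply: is_idD => //.
exact: is_idMl.
Qed.

Lemma colon_id J w : is_id J -> is_id (colon J w).
Proof.
move=> hJ; split; first by rewrite /colon mul0r; case: hJ.
move=> a b c Jb Jc; rewrite /colon /GRing.scale /= mulrDl -mulrA.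
by case: hJ => _; apply.
Qed.

Definition max_colon J w : Prop :=
  ~ J w /\ forall v, ~ J v -> (forall a, J (a * w) -> J (a * v)) ->
    forall a, J (a * v) -> J (a * w).

(** If $ab$ kills $w$ modulo $J$ and $bw\notin J$, the annihilator of $bw$ contains that of $w$,
    hence equals it by maximality, and $a$ lies in it. *)
Lemma max_colon_prime J w : is_id J -> max_colon J w -> is_prime (colon J w).
Proof.
move=> hJ [Jw wmax]; split; [exact: colon_id | by rewrite /colon mul1r |].
move=> a b; rewrite /colon => Jab; have [?|Jb] := pselect (J (b * w)); first by right.
left; apply: (wmax _ Jb); first by move=> c Jc; rewrite mulrCA; apply: is_idMl.
by rewrite mulrA.
Qed.

Lemma max_colon_exists J u : is_id J -> ~ J u ->
  exists2 w, max_colon J w & forall a, J (a * u) -> J (a * w).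
Proof.
move=> hJ Ju.
have [|A [hA [w [Jw Aw uw]] Amax]] := noeth_max noethR (Phi := fun A =>
    exists w, [/\ ~ J w, (forall a, A a <-> J (a * w))
      & forall a, J (a * u) -> J (a * w)]).
  by exists (colon J u); [exact: colon_id | exists u].
exists w => //; split=> // v Jv wv a av; apply/Aw; move: a av; apply: Amax.
- exact: colon_id.
- by exists v; split=> // b /uw; apply: wv.
- by move=> b /Aw; apply: wv.
Qed.

Lemma prod_avoid (T : eqType) (s : seq T) (C : T -> R -> Prop) P :
  is_prime P -> (forall u, is_id (C u)) ->
  (forall u, u \in s -> exists2 p, C u p & ~ P p) ->
  exists2 q, ~ P q & forall u, u \in s -> C u q.
Proof.
move=> [hP P1 Pp] hC; elim: s => [|u s IH] H; first by exists 1.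
have [|q Pq qs] := IH; first by move=> v vs; apply: H; rewrite inE vs orbT.
have [p up Pu] := H u (mem_head _ _).
exists (p * q); first by case/Pp.
move=> v; rewrite inE => /orP[/eqP->|/qs]; first exact: is_idMr.
exact: is_idMl.
Qed.

(** [U] is an arbitrary set, not a submodule, so the maximal ideal is taken among those spanned by
    finite subsets of [U]. *)
Lemma noeth_lspan_set (U : R -> Prop) :
  exists s : seq R^o, (forall y, y \in s -> U y) /\ forall u, U u -> lspan s u.
Proof.
have [|A [hA [s [sU As]] Amax]] := noeth_max noethR (Phi := fun A =>
    exists s : seq R^o, (forall y, y \in s -> U y) /\ forall a, A a <-> lspan s a).
  exists (lspan ([::] : seq R^o)); first exact: lspan_sub.
  by exists [::].
exists s; split=> // u Uu; apply/As; apply: (Amax (lspan (u :: s : seq R^o))).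
- exact: lspan_sub.
- exists (u :: s); split=> // y; rewrite inE => /orP[/eqP->//|]; exact: sU.
- by move=> x /As xs; exists 0; rewrite scale0r subr0.
- by apply/lspan_mem/mem_head.
Qed.

Lemma max_colon_avoid J I (us : seq R) : is_id J -> is_id I ->
  (forall u, u \in us -> max_colon J u) ->
  (exists2 u, u \in us & forall x, I x -> J (x * u)) \/
  exists2 x, I x & forall u, u \in us -> ~ J (x * u).
Proof.
move=> hJ hI; elim: us => [|u us IH] H.
  by right; exists 0; [case: hI|].
have [|[v vs Iv]|[x Ix xs]] := IH.
- by move=> v vs; apply: H; rewrite inE vs orbT.
- by left; exists v => //; rewrite inE vs orbT.
have [Jxu|Jxu] := pselect (J (x * u)); last first.
  by right; exists x => // v; rewrite inE => /orP[/eqP->|/xs].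
have [Iu|/existsNP[y /not_implyP[Iy Jyu]]] := pselect (forall y, I y -> J (y * u)).
  by left; exists u; rewrite ?mem_head.
have mu := H u (mem_head _ _); have pu := max_colon_prime hJ mu.
have [|//|q Jq qs] := @prod_avoid _ us (fun v => colon J v) _ pu.
- by move=> v; apply: colon_id.
- move=> v vs; apply: contrapT => nov; apply: (xs v vs).
  have [_ vmax] := H v (mem_behead (s := u :: us) vs).
  apply: (vmax u) => //; first by case: mu.
  by move=> a av; apply: contrapT => au; apply: nov; exists a.
(* As in prime avoidance: [q] lies in all the other colon ideals but not in that of [u], while [y]
   avoids that of [u]. Such a [q] exists because two comparable maximal colon ideals are equal. *)
right; exists (x + y * q).
  by apply: is_idD => //; apply: is_idMr.
move=> v; rewrite inE => /orP[/eqP->|vs] Jv.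
  have : J (y * q * u).
    by rewrite -[y * q](addKr x) mulrDl mulNr addrC; apply: is_idB.
  by case: pu => _ _ h /h[].
apply: (xs v vs); rewrite -[x](addrK (y * q)) mulrBl; apply: is_idB => //.
by rewrite -mulrA; apply: is_idMl => //; apply: qs.
Qed.

(** The zero divisors on $R/J$ are covered by finitely many maximal colon ideals: a finite [s] spans
    all elements with such a colon ideal, and for each such [w] some [u] in [s] has colon ideal
    inside that of [w], since a product killing all of [s] also kills [w]. Prime avoidance then
    decides. *)
Lemma nzd_or_colon J I : is_id J -> is_id I ->
  (exists2 x, I x & nzd J x) \/
  exists w, [/\ ~ J w, is_prime (colon J w) & forall x, I x -> J (x * w)].
Proof.
move=> hJ hI; have [s [sm ms]] := noeth_lspan_set (max_colon J).
have [[u us Iu]|[x Ix xs]] := max_colon_avoid hJ hI sm.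
  by right; exists u; split=> //; [case: (sm u us) | exact/max_colon_prime/sm].
left; exists x => // a Jxa; apply: contrapT => Ja.
have [w mw aw] := max_colon_exists hJ Ja.
have pw := max_colon_prime hJ mw.
suff [u us uw] : exists2 u, u \in s & forall a, J (a * u) -> J (a * w).
  apply: (xs u us); have [_ h] := sm u us; apply: (h w) => //; first by case: mw.
  exact: aw.
apply: contrapT => nou.
have [|u us|q Jq qs] := @prod_avoid _ s (fun v => colon J v) _ pw.
- by move=> v; apply: colon_id.
- apply: contrapT => np; apply: nou; exists u => // b bu.
  by apply: contrapT => bw; apply: np; exists b.
apply: Jq; rewrite /colon mulrC.
suff : colon J q w by [].
apply: (@lspan_min _ R^o s); [exact: colon_id | | exact: ms].
by move=> y /qs; rewrite /colon mulrC.
Qed.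

(** An ideal maximal among those containing [J] and missing the multiplicative set [S] is prime. *)
Lemma prime_avoid (S : R -> Prop) J :
  is_id J -> S 1 -> (forall a b, S a -> S b -> S (a * b)) ->
  (forall a, S a -> ~ J a) ->
  exists Q, [/\ is_prime Q, forall a, J a -> Q a & forall a, S a -> ~ Q a].
Proof.
move=> hJ S1 SM SJ.
have [|Q [hQ [JQ SQ] Qmax]] := noeth_max noethR (Phi := fun A =>
    (forall a, J a -> A a) /\ forall a, S a -> ~ A a).
  by exists J.
exists Q; split=> //; split=> //; first exact: SQ.
have meet c : ~ Q c -> exists2 s, S s & idadd Q c s.
  move=> Qc; apply: contrapT => nos; apply: Qc; apply: (Qmax (idadd Q c)).
  - exact: idadd_id.
  - split; first by move=> a /JQ; apply: idadd_sub.
    by move=> a Sa ca; apply: nos; exists a.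
  - by move=> b; apply: idadd_sub.
  - exact: idadd_mem.
move=> a b Qab; apply: contrapT => /not_orP[/meet[s Ss [r sr]] /meet[t St [u tu]]].
apply: (SQ _ (SM _ _ Ss St)).
have -> : s * t = (s - r * a) * t + ((t - u * b) * (r * a) + r * u * (a * b)) by ring.
by apply: is_idD => //; [exact: is_idMr|apply: is_idD => //; [exact: is_idMr|exact: is_idMl]].
Qed.

(** The contraction to $R$ of the extension of [A] to the localisation at [P]. *)
Definition satur P A : R -> Prop := fun a => exists2 t, ~ P t & A (t * a).

Lemma satur_id P A : is_prime P -> is_id A -> is_id (satur P A).
Proof.
move=> [hP P1 Pp] hA; split; first by exists 1; rewrite // mulr0; case: hA.
move=> a x y [t Pt Ax] [u Pu Ay]; exists (t * u); first by case/Pp.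
have -> : t * u * (a *: (x : R^o) + y) = a * u * (t * x) + t * (u * y).
  by rewrite /GRing.scale /=; ring.
by apply: is_idD => //; apply: is_idMl.
Qed.

Lemma satur_sub P A a : is_prime P -> A a -> satur P A a.
Proof. by move=> [_ P1 _] Aa; exists 1; rewrite ?mul1r. Qed.

Lemma saturK P A t a : is_prime P -> ~ P t -> satur P A (t * a) -> satur P A a.
Proof.
move=> [_ _ Pp] Pt [u Pu]; rewrite mulrA => Aa; exists (u * t) => //.
by case/Pp.
Qed.

(* R_P / (P0 + x) is Artinian: it suffices to test the descending chain D
   against larger and larger ideals E, and a maximal such E is everything. *)
Lemma prime_dcc P P0 x (D : nat -> R -> Prop) :
  is_prime P -> is_id P0 ->
  (forall P', is_prime P' -> (forall a, P0 a -> P' a) -> P' x ->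
     (forall a, P' a -> P a) -> forall a, P a -> P' a) ->
  (forall n, is_id (D n)) -> (forall n a, D n.+1 a -> D n a) ->
  (forall n t a, ~ P t -> D n (t * a) -> D n a) ->
  (forall n, D n x) -> (forall n a, P0 a -> D n a) ->
  exists n, forall a, D n a -> D n.+1 a.
Proof.
move=> pP hP0 Pmin hD Ddec Dsat Dx DP0.
have Dle n k a : (n <= k)%N -> D k a -> D n a.
  by move=> /subnK <-; elim: (k - n)%N => // i IH; rewrite addSn => /Ddec.
have [|E [hE [Ex EP0 [n0 n0E]] Emax]] := noeth_max noethR (Phi := fun E =>
   [/\ E x, forall a, P0 a -> E a &
    exists n, forall k a, (n <= k)%N -> D k a -> E a -> D k.+1 a]).
  exists (idadd P0 x); first exact: idadd_id.
  split; [exact: idadd_mem | by move=> b; apply: idadd_sub |].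
  exists 0%N => k a _ _; apply: (@idadd_min _ _ (D k.+1)) => //; exact: DP0.
have Esat a : satur P E a -> E a.
  apply: Emax; [exact: satur_id | | by move=> b; apply: satur_sub].
  split; [exact: satur_sub | by move=> b /EP0; apply: satur_sub |].
  exists n0 => k b n0k Db [t Pt Et]; apply: (Dsat _ t) => //; apply: n0E => //.
  exact: is_idMl.
have [[t Et Pt]|EP] := pselect (exists2 t, E t & ~ P t).
  exists n0 => a Da; apply: (Dsat _ t) => //; apply: n0E => //; first exact: is_idMl.
  exact: is_idMr.
have E1 : ~ E 1 by move=> E1; apply: EP; exists 1; case: pP.
have [w mw _] := max_colon_exists hE E1.
have pw := max_colon_prime hE mw; have [Ew _] := mw.
have Pw a : P a -> E (a * w).
  apply: (Pmin (colon E w)) => //.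
  - by move=> b /EP0 Eb; apply: is_idMr.
  - exact: is_idMr.
  - move=> b Eb; apply: contrapT => Pb; apply: Ew; apply: Esat; by exists b.
have [] := Ew; apply: (Emax (idadd E w)); last exact: idadd_mem.
- exact: idadd_id.
- split; [exact: idadd_sub | by move=> b /EP0; apply: idadd_sub |].
  (* Locally at [P], [T n] says that [w] lies in [D n + E]. If this fails once, then from there on
     the elements of [D k] in [E + (w)] already lie in [E]; if it never fails, subtracting a
     multiple of [a w + e] taken from [D k.+1] reduces to [E]. *)
  pose T n := exists a, ~ P a /\ exists2 e, E e & D n (a * w + e).
  have [[n1 T1]|noT] := pselect (exists n, ~ T n).
    exists (maxn n0 n1) => k z; rewrite geq_max => /andP[n0k n1k] Dz [r Er].
    apply: n0E => //; rewrite -[z](subrK (r * w)); apply: is_idD => //; apply: Pw.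
    apply: contrapT => Pr; apply: T1; exists r; split=> //; exists (z - r * w) => //.
    by rewrite addrC subrK; apply: Dle Dz.
  exists n0 => k z n0k Dz [r Er].
  have [a [Pa [e Ee Dae]]] : T k.+1 by apply: contrapT => nT; apply: noT; exists k.+1.
  apply: (Dsat _ a) => //; rewrite -[a * z](subrK (r * (a * w + e))).
  apply: is_idD => //; last exact: is_idMl.
  apply: n0E => //.
    by apply: is_idB => //; apply: is_idMl => //; apply: Ddec.
  have -> : a * z - r * (a * w + e) = a * (z - r * w) - r * e by ring.
  by apply: is_idB => //; apply: is_idMl.
- by move=> b; apply: idadd_sub.
Qed.

(* The ideal Q A + P0, as an intersection of ideals. *)
Definition idprod Q A P0 : R -> Prop := fun a => forall C, is_id C ->
  (forall b, P0 b -> C b) -> (forall q b, Q q -> A b -> C (q * b)) -> C a.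

Lemma idprod_id Q A P0 : is_id (idprod Q A P0).
Proof.
split=> [C hC _ _|a x y Ax Ay C hC C1 C2]; first by case: hC.
by case: (hC) => _; apply; [apply: Ax | apply: Ay].
Qed.

(* The symbolic powers of Q in R / P0. *)
Fixpoint symb Q P0 n : R -> Prop :=
  if n is n'.+1 then satur Q (idprod Q (symb Q P0 n') P0) else fun=> True.

(* Krull's principal ideal theorem in R / P0. *)
Lemma krull_principal P0 Q P x :
  is_prime P0 -> is_prime Q -> is_prime P ->
  (forall a, P0 a -> Q a) -> ~ (forall a, Q a -> P0 a) ->
  (forall a, Q a -> P a) -> ~ (forall a, P a -> Q a) ->
  (forall P', is_prime P' -> (forall a, P0 a -> P' a) -> P' x ->
     (forall a, P' a -> P a) -> forall a, P a -> P' a) -> P x ->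
  False.
Proof.
move=> pP0 pQ pP P0Q QP0 QP PQ Pmin Px.
have Qx : ~ Q x by move=> Qx; apply: PQ; apply: Pmin.
pose A := symb Q P0.
have hA n : is_id (A n).
  by case: n => [//|n]; apply: satur_id => //; apply: idprod_id.
have Adec n a : A n.+1 a -> A n a.
  elim: n a => // n IH a [t Qt ta]; exists t => // C hC C1 C2.
  by apply: ta => // q b Qq /IH; apply: C2.
have Asat n t a : ~ Q t -> A n (t * a) -> A n a.
  by case: n => // n; apply: saturK.
have AP0 n a : P0 a -> A n a.
  by case: n => // n P0a; apply: satur_sub => // C hC C1 _; apply: C1.
have [P0p Qp] : is_id P0 /\ is_id Q by case: pP0; case: pQ.
(* The chain $A_n+(x)$ stabilises locally at [P]. Since [x] is outside [Q] and $A_n$ is saturated at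
   [Q], this means $A_n\subseteq A_{n+1}+xA_n$ locally at [P], and Nakayama at [P] gives
   $A_n=A_{n+1}$. *)
have [|||||n nD] := @prime_dcc P P0 x (fun n => satur P (idadd (A n) x)) pP P0p Pmin.
- by move=> n; apply: satur_id => //; apply: idadd_id.
- by move=> n a [t Pt [r /Adec ta]]; exists t => //; exists r.
- by move=> n t a; apply: saturK.
- by move=> n; apply: satur_sub => //; apply: idadd_mem.
- by move=> n a /(AP0 n) Aa; apply: satur_sub => //; apply: idadd_sub.
have [s [sA As]] := noeth_fg noethR (hA n).
have hP : is_id P by case: pP.
have [|t Pt tA] := @nakayama _ R^o P (A n.+1) s pP (hA _).
  move=> y /sA Ay; have [|t Pt [r tr]] := nD y.
    by apply: satur_sub => //; apply: idadd_sub.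
  have Ar : A n r.
    apply: (Asat _ x) => //; rewrite mulrC -[r * x](subKr (t * y)).
    by apply: is_idB => //; [exact: is_idMl | exact: Adec].
  exists t => //.
  suff : @lin R R^o P (A n.+1) s ((t * y - r * x : R^o) + x *: (r : R^o)).
    by rewrite /GRing.scale /= [x * r]mulrC subrK.
  apply: is_subD; [exact: (lin_sub _ hP (hA n.+1)) | exact: lin_base |].
  by apply: lin_scale => //; [exact: hA | apply: As].
have AA a : A n a -> A n.+1 a.
  by move=> /As/tA; apply: Asat => /QP.
(* Locally at [Q] now $A_n=QA_n+P_0$, so Nakayama at [Q] puts $uA_n$ into $P_0$ for some $u\notin
   Q$. Since $q^n\in A_n$, the prime $P_0$ would contain [u] or [q]. *)
have [|u Qu uA] := @nakayama _ R^o Q P0 s pQ P0p.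
  move=> y /sA/AA[u Qu uy]; exists u => //; apply: uy.
  - exact: lin_sub.
  - by move=> b; apply: lin_base.
  - by move=> q b Qq /As sb; apply: (@lin_scale _ R^o).
case: QP0 => q Qq.
have qn : A n (q ^+ n).
  elim: (n) => // k IH; rewrite exprS; apply: satur_sub => // C hC _ C2; exact: C2.
have : P0 (u * q ^+ n) by apply: (uA _ (As _ qn)).
case: pP0 => _ P01 P0m /P0m[/P0Q//|].
elim: (n) => [//|k IH]; rewrite exprS => /P0m[//|]; exact: IH.
Qed.

(** If [x] is in [P0], then [P1] serves. Otherwise, without such a prime, [P2] would be minimal over
    [P0] and [x] although [P1] lies strictly between, against Krull's theorem. *)
Lemma prime_between P0 P1 P2 x :
  is_prime P0 -> is_prime P1 -> is_prime P2 ->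
  (forall a, P0 a -> P1 a) -> ~ (forall a, P1 a -> P0 a) ->
  (forall a, P1 a -> P2 a) -> ~ (forall a, P2 a -> P1 a) -> P2 x ->
  exists P', [/\ is_prime P', P' x,
    (forall a, P0 a -> P' a) /\ ~ (forall a, P' a -> P0 a) &
    (forall a, P' a -> P2 a) /\ ~ (forall a, P2 a -> P' a)].
Proof.
move=> p0 p1 p2 s01 n01 s12 n12 x2.
have [x0|x0] := pselect (P0 x).
  by exists P1; split=> //; apply: s01.
apply: contrapT => noP; apply: (@krull_principal P0 P1 P2 x) => //.
move=> P' p' P0P' x' P'P2; apply: contrapT => P2P'; apply: noP; exists P'.
by split=> //; split=> // h; apply: x0; apply: h.
Qed.

(* n counts the strict inclusions, so that a chain has n+1 members. *)
Fixpoint chain n P Q : Prop := is_prime P /\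
  if n is n'.+1 then exists P',
    [/\ forall a, P a -> P' a, ~ (forall a, P' a -> P a) & chain n' P' Q]
  else P = Q.

Lemma chain_prime n P Q : chain n P Q -> is_prime P.
Proof. by case: n => [|n] []. Qed.

Lemma chain_last n P Q : chain n P Q -> is_prime Q.
Proof.
elim: n P => [|n IH] P [pP]; first by move=> <-.
by move=> [P' [_ _ /IH]].
Qed.

Lemma chain_cat n k P Q S : chain n P Q -> chain k Q S -> chain (n + k) P S.
Proof.
elim: n P => [|n IH] P [pP]; first by move=> ->.
move=> [P' [PP' P'P h]] h'; split=> //; exists P'; split=> //; exact: IH.
Qed.

(** Exchanging one member at a time from the top downwards brings [x] into every member above [P],
    so dividing by [x] costs only one step of the chain. *)
Lemma chain_push n P Q x : chain n.+1 P Q -> Q x ->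
  exists P', [/\ P' x, (forall a, P a -> P' a), ~ (forall a, P' a -> P a) & chain n P' Q].
Proof.
elim: n P => [|n IH] P [pP [P1 [s01 n01 c1]]] Qx.
  by exists P1; split=> //; case: c1 => _ ->.
have [P2 [x2 s12 n12 c2]] := IH _ c1 Qx.
have [P' [p' x' [s0 n0] [s2 n2]]] :=
  prime_between pP (proj1 c1) (chain_prime c2) s01 n01 s12 n12 x2.
by exists P'; split=> //; split=> //; exists P2.
Qed.

(* The ideal J + (s). *)
Fixpoint adds J (s : seq R) : R -> Prop :=
  if s is x :: s' then adds (idadd J x) s' else J.

Fixpoint regs J (s : seq R) : Prop :=
  if s is x :: s' then nzd J x /\ regs (idadd J x) s' else True.

Lemma adds_id J s : is_id J -> is_id (adds J s).
Proof. by elim: s J => //= x s IH J /(idadd_id x); apply: IH. Qed.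

Lemma adds_sub J s a : J a -> adds J s a.
Proof. by elim: s J => //= x s IH J /(@idadd_sub _ x); apply: IH. Qed.

Lemma adds_mem J s x : is_id J -> x \in s -> adds J s x.
Proof.
elim: s J => //= y s IH J hJ; rewrite inE => /orP[/eqP->|xs].
  by apply: adds_sub; apply: idadd_mem.
by apply: IH => //; apply: idadd_id.
Qed.

Lemma adds_min J s A a : is_id A -> (forall b, J b -> A b) ->
  (forall y, y \in s -> A y) -> adds J s a -> A a.
Proof.
move=> hA; elim: s J => [|x s IH] J JA sA /=; first exact: JA.
apply: IH => [b|y ys]; last by apply: sA; rewrite inE ys orbT.
by apply: idadd_min => //; apply: sA; rewrite mem_head.
Qed.

Lemma regs_rcons J s x : regs J (rcons s x) <-> regs J s /\ nzd (adds J s) x.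
Proof.
elim: s J => [|y s IH] J /=; first by split=> [[? _]|[_ ?]].
by split=> [[? /IH[]]|[[? ?] ?]]; split=> //; apply/IH.
Qed.

Lemma regs_height s P : is_prime P -> (forall x, x \in s -> P x) ->
  regs (fun a => a = 0) s -> exists P0, chain (size s) P0 P.
Proof.
have h0 : is_id (fun a : R => a = 0).
  by split=> // a x y -> ->; rewrite scaler0 addr0.
elim/last_ind: s P => [|s x IH] P pP sP; first by move=> _; exists P.
rewrite regs_rcons => -[rs xs].
have hJ := adds_id s h0; set J := adds _ s in xs hJ.
have Px : P x by apply: sP; rewrite mem_rcons mem_head.
have ssP y : y \in s -> P y.
  by move=> ys; apply: sP; rewrite mem_rcons inE ys orbT.
have [hP P1 Pp] := pP.
have JP a : J a -> P a by apply: adds_min => // b ->; case: hP.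
(* The multiplicative set generated by [x] and the complement of [P] misses [J] because [x] is a
   nonzerodivisor modulo [J]. A prime over [J] avoiding it lies in [P] and omits [x], so it is
   strictly smaller. *)
have [|||Q [pQ JQ SQ]] := @prime_avoid (fun a => exists t k, ~ P t /\ a = t * x ^+ k) J hJ.
- by exists 1, 0%N; rewrite mul1r.
- move=> _ _ [t [k [Pt ->]]] [u [l [Pu ->]]]; exists (t * u), (k + l)%N.
  by split; [case/Pp | rewrite exprD; ring].
- move=> _ [t [k [Pt ->]]] Jtx; apply: Pt; apply: JP.
  elim: k Jtx => [|k IHk]; first by rewrite mulr1.
  by rewrite exprS mulrCA => /xs.
have Qx : ~ Q x by apply: SQ; exists 1, 1%N; rewrite mul1r expr1.
have QP a : Q a -> P a.
  move=> Qa; apply: contrapT => Pa; apply: (SQ a) => //.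
  by exists a, 0%N; rewrite mulr1.
have [|P0 c0] := IH Q pQ _ rs.
  by move=> y ys; apply: JQ; apply: adds_mem.
exists P0; rewrite size_rcons -addn1; apply: chain_cat c0 _; split=> //.
by exists P; split=> // h; apply: Qx; apply: h.
Qed.

End Primes.

(** * Chains of primes and systems of parameters in a local ring *)

Section Local.
Variables (R : comNzRingType) (m : R -> Prop).
Hypothesis noethR : noetherian R.
Hypothesis pm : is_prime m.
Hypothesis mu : forall t, ~ m t -> exists u, u * t = 1.
Implicit Types J A P Q : R -> Prop.

Lemma local_nakayama (V : lmodType R) (A : V -> Prop) s :
  is_sub A -> (forall y, y \in s -> lin m A s y) -> forall y, lspan s y -> A y.
Proof.
move=> hA sl y ys; have [|t mt tA] := @nakayama _ V m A s pm hA.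
  by move=> z /sl zs; exists 1; [case: pm | rewrite scale1r].
have [u ut] := mu mt.
by rewrite -[y]scale1r -ut -scalerA; apply: is_subZ => //; apply: tA.
Qed.

Lemma adds_height J s P0 : is_id J -> adds J s = m -> (forall a, J a -> P0 a) ->
  ~ chain (size s).+1 P0 m.
Proof.
elim: s J P0 => [|x s IH] J P0 hJ Jm JP0 c.
  case: c => _ [P1 [_ n01 [_ P1m]]]; apply: n01 => a; rewrite P1m -[m]Jm; exact: JP0.
have mx : m x by rewrite -Jm /=; apply: adds_sub; apply: idadd_mem.
have [P1 [x1 s01 n01 c1]] := chain_push noethR c mx.
apply: (IH (idadd J x) P1) => //; first exact: idadd_id.
move=> a; apply: idadd_min => //; first by case: (chain_prime c1).
by move=> b /JP0/s01.
Qed.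

(* By Krull's theorem the next prime P1 of a chain pushed above x is J + (x), so
   that P0 = J + x P0 and Nakayama gives J = P0. *)
Lemma regular_domain J s P0 : is_id J -> adds J s = m -> (forall a, J a -> P0 a) ->
  chain (size s) P0 m -> is_prime J /\ regs J s.
Proof.
elim: s J P0 => [|x s IH] J P0 hJ /= Jm JP0 c; first by rewrite Jm.
have mx : m x by rewrite -Jm /=; apply: adds_sub; apply: idadd_mem.
have [P1 [x1 s01 n01 c1]] := chain_push noethR c mx.
have JxP1 a : idadd J x a -> P1 a.
  apply: idadd_min => //; first by case: (chain_prime c1).
  by move=> b /JP0/s01.
have hJx := idadd_id x hJ.
have [pJx rs] := IH _ _ hJx Jm JxP1 c1.
have P1Jx a : P1 a -> idadd J x a.
  move: a; apply: contrapT => n; apply: (@adds_height (idadd J x) s (idadd J x)) => //.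
  by split=> //; exists P1; split.
have p0 := proj1 c; have [hP0 _ P0p] := p0.
have x0 : ~ P0 x.
  move=> x0; apply: n01 => a /P1Jx; apply: idadd_min => //.
have [g [gP0 P0g]] := noeth_fg noethR hP0.
have P0J : forall a, P0 a -> J a.
  move=> a /P0g; move: a; apply: (@local_nakayama R^o) => // y /gP0 y0.
  have [r yr] := P1Jx _ (s01 _ y0).
  have hm : is_id m by case: pm.
  have r0 : P0 r.
    suff /P0p[] : P0 (r * x) by [].
    by rewrite -[r * x](subKr y); apply: is_idB => //; apply: JP0.
  suff : @lin R R^o m J g ((y - r * x : R^o) + x *: (r : R^o)).
    by rewrite /GRing.scale /= [x * r]mulrC subrK.
  apply: is_subD; [exact: lin_sub | exact: lin_base |].
  by apply: lin_scale => //; apply: P0g.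
have JE : J = P0 by apply/funext => a; apply/propext; split; [exact: JP0|exact: P0J].
by rewrite JE; split=> //; split; [move=> a /P0p[] | rewrite -JE].
Qed.

End Local.

(** * Free resolutions and vanishing of Ext *)

Section LinearRelations.
Variable R : comNzRingType.

(** Linear maps are extracted from linear relations: totality suffices on a free module, where
    images of a basis are chosen; elsewhere single-valuedness is needed as well. *)
Definition linrel (U V : lmodType R) (r : U -> V -> Prop) : Prop :=
  r 0 0 /\ forall a u u' v v', r u v -> r u' v' -> r (a *: u + u') (a *: v + v').

Lemma linrel_sum (U V : lmodType R) (r : U -> V -> Prop) (I : Type) (t : seq I)
    (F : I -> U) (G : I -> V) :
  linrel r -> (forall i, r (F i) (G i)) -> r (\sum_(i <- t) F i) (\sum_(i <- t) G i).
Proof.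
move=> [r0 rl] h; apply: (big_ind2 r) => // u v u' v' uv uv'.
by rewrite -[u]scale1r -[v]scale1r; apply: rl.
Qed.

Section Combinations.
Variables (U V W : lmodType R).
Definition lid : {linear U -> U} := idfun.
Definition lscale x (f : {linear U -> V}) : {linear U -> V} := x \*: f.
Definition lsub (f g : {linear U -> V}) : {linear U -> V} := f \- g.
Definition ladd (f g : {linear U -> V}) : {linear U -> V} := f \+ g.
Definition lcomp (g : {linear V -> W}) (f : {linear U -> V}) : {linear U -> W} :=
  g \o f.
End Combinations.

Lemma vect_basisE (V : vectType R) (v : V) :
  v = \sum_i v2r v 0 i *: r2v (delta_mx 0 i).
Proof.
rewrite -[LHS]v2rK [X in r2v X]row_sum_delta linear_sum.
by apply: eq_bigr => i _; rewrite linearZ.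
Qed.

Lemma free_linrel (V : vectType R) (W : lmodType R) (r : V -> W -> Prop) :
  linrel r -> (forall v, exists w, r v w) ->
  exists h : {linear V -> W}, forall v, r v (h v).
Proof.
move=> hr rt; have rt' i : {w | r (r2v (delta_mx 0 i)) w} by apply/cid/rt.
have [|h hE] := @linear_fun R V W (fun v => \sum_i v2r v 0 i *: sval (rt' i)).
  move=> a u v; rewrite scaler_sumr -big_split; apply: eq_bigr => i _.
  by rewrite linearP !mxE scalerDl scalerA.
exists h => v; rewrite hE {1}[v]vect_basisE; apply: linrel_sum => // i.
have [r0 rl] := hr; rewrite -[_ *: r2v _]addr0 -[_ *: sval _]addr0; apply: rl => //.
exact: svalP.
Qed.

Lemma fun_linrel (V W : lmodType R) (r : V -> W -> Prop) :
  linrel r -> (forall v, exists w, r v w) -> (forall w, r 0 w -> w = 0) ->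
  exists h : {linear V -> W}, forall v, r v (h v).
Proof.
move=> [r0 rl] rt rf; have rt' v : {w | r v w} by apply/cid/rt.
have [|h hE] := @linear_fun R V W (fun v => sval (rt' v)); last first.
  by exists h => v; rewrite hE; apply: svalP.
move=> a u v; set w := a *: u + v; apply/eqP; rewrite -subr_eq0; apply/eqP/rf.
have := rl (-1) _ _ _ _ (rl a _ _ _ _ (svalP (rt' u)) (svalP (rt' v))) (svalP (rt' w)).
by rewrite !scaleN1r [X in r X _]addNr [X in r _ X]addrC.
Qed.

Lemma lift_free (V : vectType R) (W T : lmodType R) (g : {linear W -> T})
    (f : {linear V -> T}) :
  (forall v, exists w, g w = f v) -> exists h : {linear V -> W}, forall v, g (h v) = f v.
Proof.
move=> gf; apply: (free_linrel (r := fun v w => g w = f v)) => //.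
by split=> [|a u u' v v' uv uv']; rewrite ?linear0 // !linearP uv uv'.
Qed.

Lemma lift_mono (V W T : lmodType R) (g : {linear W -> T}) (f : {linear V -> T}) :
  injective g -> (forall v, exists w, g w = f v) ->
  exists h : {linear V -> W}, forall v, g (h v) = f v.
Proof.
move=> gI gf; apply: (fun_linrel (r := fun v w => g w = f v)) => //.
  by split=> [|a u u' v v' uv uv']; rewrite ?linear0 // !linearP uv uv'.
by move=> w; rewrite linear0 => gw; apply: gI; rewrite gw linear0.
Qed.

Lemma factor_surj (V W T : lmodType R) (f : {linear V -> W}) (k : {linear V -> T}) :
  (forall w, exists v, f v = w) -> (forall v, f v = 0 -> k v = 0) ->
  exists h : {linear W -> T}, forall v, h (f v) = k v.
Proof.
move=> fs fk.
have [||w [v vw vt]|h hP] := @fun_linrel W T (fun w t => exists2 v, f v = w & k v = t).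
- split; first by exists 0; rewrite linear0.
  move=> a w w' t t' [v <- <-] [v' <- <-]; exists (a *: v + v'); exact: linearP.
- by move=> w; have [v vw] := fs w; exists (k v), v.
- by rewrite -vt; apply: fk.
exists h => v; have [u uv <-] := hP (f v); apply/eqP; rewrite -subr_eq0 -linearB.
by apply/eqP; apply: fk; rewrite linearB uv subrr.
Qed.

Lemma quot_pi (V : lmodType R) (S : submodClosed V) :
  exists p : {linear V -> quotmod S},
    (forall y, exists x, p x = y) /\ forall x, p x = 0 <-> x \in S.
Proof.
have [|p pE] := @linear_fun R V (quotmod S) (\pi_(quotmod S)).
  by move=> a x y; rewrite -(pi_quotmodD S) -(pi_quotmodZ S).
exists p; split=> [y|x]; first by exists (repr y); rewrite pE reprK.
by have := @pi_quotmodE R V S x 0; rewrite subr0 -!pE linear0.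
Qed.

Lemma resolutionP (M : lmodType R) (F : free_resolution M) :
  @is_resolution R M (fun i => 'rV[R]_(rk F i)) (bd F) (aug F).
Proof. by case: F. Qed.

Lemma bdbd (M : lmodType R) (F : free_resolution M) i x : bd F i (bd F i.+1 x) = 0.
Proof. by have [_ _ h] := resolutionP F; apply/h; exists x. Qed.

Lemma bd_exact (M : lmodType R) (F : free_resolution M) i x :
  bd F i x = 0 -> exists y, bd F i.+1 y = x.
Proof. by have [_ _ h] := resolutionP F => /h. Qed.

Lemma augbd (M : lmodType R) (F : free_resolution M) x : aug F (bd F 0 x) = 0.
Proof. by have [_ h _] := resolutionP F; apply/h; exists x. Qed.

Lemma aug_exact (M : lmodType R) (F : free_resolution M) x :
  aug F x = 0 -> exists y, bd F 0 y = x.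
Proof. by have [_ h _] := resolutionP F => /h. Qed.

Lemma aug_onto (M : lmodType R) (F : free_resolution M) x : exists y, aug F y = x.
Proof. by have [h _ _] := resolutionP F. Qed.

End LinearRelations.

Section ExtVanishing.
Variables (R : comNzRingType) (M : lmodType R) (L : free_resolution M).
Implicit Types J : R -> Prop.

(** Cochains with values in $R/J$ are represented by maps into $R$ taken modulo [J]; since the terms
    of [L] are free, every cochain lifts. In degree 0 only the zero class is a coboundary. *)
Definition cobound J i : ('rV[R]_(rk L i) -> R^o) -> Prop :=
  if i is j.+1 then fun phi => exists psi : {linear 'rV[R]_(rk L j) -> R^o},
     forall u, J (phi u - psi (bd L j u))
  else fun phi => forall u, J (phi u).

(* Ext^i(M, R/J) = 0. *)
Definition ext_vanishes J i : Prop :=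
  forall phi : {linear 'rV[R]_(rk L i) -> R^o},
    (forall u, J (phi (bd L i u))) -> cobound J phi.

Lemma linrel_idadd J x (V : lmodType R) (f : {linear V -> R^o}) : is_id J ->
  linrel (fun v (r : R^o) => J (f v - r * x)).
Proof.
move=> hJ; split; first by rewrite linear0 mul0r subr0; case: hJ.
move=> a u u' v v' uv uv'; rewrite linearP /GRing.scale /=.
have -> : a * f u + f u' - (a * v + v') * x = a * (f u - v * x) + (f u' - v' * x).
  by ring.
by apply: is_idD => //; apply: is_idMl.
Qed.

(* Only the consequence bd s bd = x bd of x = bd s + s bd is kept, so that the
   homotopy can be built one degree at a time; see homotopyS. *)
Lemma homotopy x i : (forall v : M, x *: v = 0) ->
  exists s : {linear 'rV[R]_(rk L i) -> 'rV[R]_(rk L i.+1)},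
    forall u, bd L i (s (bd L i u)) = x *: bd L i u.
Proof.
move=> xM.
elim: i => [|i [s sE]].
  have [|s sE] := lift_free (g := bd L 0) (f := lscale x (lid _)).
    by move=> u; apply: aug_exact; rewrite linearZ /= xM.
  by exists s => u; rewrite sE.
have [|t tE] := lift_free (g := bd L i.+1)
    (f := lsub (lscale x (lid _)) (lcomp s (bd L i))).
  by move=> u; apply: bd_exact; rewrite /= linearB linearZ /= sE subrr.
by exists t => u; rewrite tE /= bdbd linear0 subr0.
Qed.

Lemma homotopyS x i (s : {linear 'rV[R]_(rk L i) -> 'rV[R]_(rk L i.+1)}) u :
  (forall u, bd L i (s (bd L i u)) = x *: bd L i u) ->
  exists v, x *: u = s (bd L i u) + bd L i.+1 v.
Proof.
move=> sE; have [|v vE] := @bd_exact _ _ L i (x *: u - s (bd L i u)).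
  by rewrite linearB linearZ /= sE subrr.
by exists v; rewrite vE addrC subrK.
Qed.

Lemma ext0_nzd J x : is_id J -> (forall v : M, x *: v = 0) -> nzd J x ->
  ext_vanishes J 0.
Proof.
move=> hJ xM Jx phi Jphi u; apply: Jx.
have [|v vE] := @aug_exact _ _ L (x *: u); first by rewrite linearZ /= xM.
by have := Jphi v; rewrite vE linearZ.
Qed.

(** The part
    $\operatorname{Ext}^i(M,R/(J,x))\to\operatorname{Ext}^{i+1}(M,R/J)\xrightarrow{x}\operatorname{Ext}^{i+1}(M,R/J)$
    of the long exact sequence, whose last map is zero. Concretely, bounding [phi s] modulo $(J,x)$
    bounds [x phi] by [x] times a coboundary modulo [J], and [x] cancels. *)
Lemma extS_nzd J x i : is_id J -> (forall v : M, x *: v = 0) -> nzd J x ->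
  ext_vanishes (idadd J x) i -> ext_vanishes J i.+1.
Proof.
move=> hJ xM Jx van phi Jphi.
have [s sE] := homotopy i xM.
have psiE u : idadd J x (phi (s (bd L i u))).
  have [v vE] := homotopyS u sE.
  exists (phi u); rewrite -[phi u * x]mulrC.
  have -> : x * phi u = phi (s (bd L i u)) + phi (bd L i.+1 v).
    by rewrite -linearD -vE linearZ.
  by rewrite opprD addrA subrr sub0r; apply: is_idN.
have [w wE] : exists w : {linear 'rV[R]_(rk L i) -> R^o},
    forall u, J (phi (s (bd L i u)) - w (bd L i u) * x).
  have {van psiE} := van (lcomp phi s) psiE.
  case: i {Jphi} phi s sE => [|i] phi s sE /=.
    move=> h; have [|w wE] := free_linrel (linrel_idadd x (lcomp phi s) hJ); first exact: h.
    by exists w => u; apply: wE.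
  move=> [chi chiE].
  have [|w wE] := free_linrel (linrel_idadd x (lsub (lcomp phi s) (lcomp chi (bd L i))) hJ).
    exact: chiE.
  by exists w => u; have := wE (bd L i.+1 u); rewrite /= bdbd linear0 subr0.
exists w => u; apply: Jx.
have [v vE] := homotopyS u sE.
have -> : x * (phi u - w (bd L i u)) =
    (phi (s (bd L i u)) - w (bd L i u) * x) + phi (bd L i.+1 v).
  have h : x * phi u = phi (s (bd L i u)) + phi (bd L i.+1 v).
    by rewrite -linearD -vE linearZ.
  by rewrite mulrBr h; ring.
exact: is_idD.
Qed.

(** Here $\operatorname{Ext}^i(M,R/(J,x))$ sits between the two vanishing groups of the same
    sequence; [chi] represents the image of [phi] under the connecting map. *)
Lemma ext_idadd J x i : is_id J -> nzd J x ->
  ext_vanishes J i -> ext_vanishes J i.+1 -> ext_vanishes (idadd J x) i.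
Proof.
move=> hJ Jx van vanS phi Jphi.
have [|chi chiE] := free_linrel (linrel_idadd x (lcomp phi (bd L i)) hJ).
  exact: Jphi.
have [|w wE] := vanS chi.
  move=> u; apply: Jx; have := chiE (bd L i.+1 u).
  by rewrite /= bdbd linear0 sub0r => /(is_idN hJ); rewrite opprK mulrC.
pose g := lsub phi (lscale x w).
have gE u : g u = phi u - w u * x by rewrite [w u * x]mulrC.
have Jg u : J (g (bd L i u)).
  rewrite gE.
  have -> : phi (bd L i u) - w (bd L i u) * x =
     (phi (bd L i u) - chi u * x) + x * (chi u - w (bd L i u)) by ring.
  by apply: is_idD => //; [exact: chiE | exact: is_idMl].
have := van g Jg; move: gE; clear; move: g => g.
case: i phi w g => [|i] phi w g gE.
  by move=> /= h u; exists (w u); rewrite -gE.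
move=> [psi psiE]; exists psi => u; exists (w u).
by rewrite addrAC -gE.
Qed.

Lemma ext_regs J s : is_id J -> (forall x, x \in s -> forall v : M, x *: v = 0) ->
  regs J s -> forall i, (i < size s)%N -> ext_vanishes J i.
Proof.
elim: s J => // x s IH J hJ sM /= [Jx rs] [|i] ilt.
  by apply: (@ext0_nzd _ x) => //; apply: sM; rewrite mem_head.
apply: (@extS_nzd _ x) => //; first by apply: sM; rewrite mem_head.
apply: IH => //; first exact: idadd_id.
by move=> y ys; apply: sM; rewrite inE ys orbT.
Qed.

Lemma ext_adds J s t : is_id J -> regs J s ->
  (forall i, (i < t + size s)%N -> ext_vanishes J i) ->
  forall i, (i < t)%N -> ext_vanishes (adds J s) i.
Proof.
elim: s J => [|x s IH] J hJ /=; first by rewrite addn0.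
move=> [Jx rs] h; apply: IH => //; first exact: idadd_id.
move=> i it; apply: ext_idadd => //; apply: h; rewrite addnS ltnS //; exact: ltnW.
Qed.

End ExtVanishing.

(** An element [u] killed by [I] modulo [J] defines a map $R/I\to R/J$, represented on the
    resolution by [lam] times [u]. *)
Lemma ext0_quotmod (R : comNzRingType) (I : ideal R)
    (L : free_resolution (quotmod I)) (J : R -> Prop) u :
  is_id J -> ext_vanishes L J 0 -> (forall x, x \in I -> J (x * u)) -> J u.
Proof.
move=> hJ van Iu; have [p [ps pI]] := quot_pi I.
have [|lam lamE] := lift_free (g := p) (f := aug L).
  by move=> v; have [w wv] := ps (aug L v); exists w.
pose g := lscale u lam.
have gE v : g v = lam v * u by rewrite [lam v * u]mulrC.
have Jg : forall v, J (g v).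
  apply: van => v; rewrite gE; apply: Iu; apply/pI; by rewrite lamE augbd.
have [e eE] := aug_onto L (p 1).
have Ie : (1 : R^o) - lam e \in I by apply/pI; rewrite linearB lamE eE subrr.
have -> : u = (1 - lam e) * u + g e by rewrite gE; ring.
by apply: is_idD => //; apply: Iu.
Qed.

(** Dependent choice for composable arrows: the state carries both endpoints, so that the source and
    target types of consecutive arrows match by conversion. It produces resolutions differential by
    differential. *)
Lemma dependent_sequence (T : Type) (X : T -> T -> Type)
    (P : forall a b c, X a b -> X b c -> Prop) (Q : forall a b, X a b -> Prop) :
  (forall a b (f : X a b), exists c (g : X b c), P a b c f g) ->
  (exists a b (f : X a b), Q a b f) ->
  exists k (g : forall i, X (k i) (k i.+1)), Q _ _ (g 0%N) /\
    forall i, P _ _ _ (g i) (g i.+1).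
Proof.
move=> cover [a [b [f Qf]]].
have step a' b' (f' : X a' b') : {c & {g : X b' c | P a' b' c f' g}}.
  by have /cid[c /cid g] := cover a' b' f'; exists c.
pose next (s : {a & {b & X a b}}) : {a & {b & X a b}} := existT _ (projT1 (projT2 s))
  (existT _ (projT1 (step _ _ (projT2 (projT2 s))))
            (sval (projT2 (step _ _ (projT2 (projT2 s)))))).
pose st i := iter i next (existT _ a (existT _ b f)).
exists (fun i => projT1 (st i)), (fun i => projT2 (projT2 (st i))); split=> // i.
exact: svalP (projT2 (step _ _ (projT2 (projT2 (st i))))).
Qed.

(** * Depth, minimal resolutions and projective dimension *)

Section LocalDepth.
Variables (R : comNzRingType) (m : ideal R).
Hypothesis noethR : noetherian R.
Hypothesis pm : is_prime (fun x : R => x \in m).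
Hypothesis mu : forall t : R, t \notin m -> exists u, u * t = 1.
Implicit Types (J P Q : R -> Prop).

Let mu' (t : R) : ~ (t \in m) -> exists u, u * t = 1.
Proof. by move=> /negP; apply: mu. Qed.

(* dim R/P >= depth R/J for P associated to R/J; the depth is read off the
   groups Ext^i(R/m, R/J). *)
Lemma chain_depth (L : free_resolution (quotmod m)) t J z : is_id J ->
  (forall i, (i < t)%N -> ext_vanishes L J i) -> ~ J z -> is_prime (colon J z) ->
  exists Q, chain t (colon J z) Q.
Proof.
elim: t J z => [|t IH] J z hJ van Jz pz; first by exists (colon J z).
have hm : is_id (fun x : R => x \in m) by case: pm.
have [[x mx Jx]|[w [Jw _ mw]]] := nzd_or_colon noethR hJ hm; last first.
  by case: Jw; apply: (ext0_quotmod hJ (van 0%N isT)).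
have hJx := idadd_id x hJ.
have zx : ~ colon J z x by move/Jx.
(* [N] is the annihilator in $R/J$ of the prime of [z]. If it lay in $J+(x)$, cancelling [x] would
   give $N\subseteq J+xN$, so $N\subseteq J$ by Nakayama, although $z\in N$. An element outside
   leads to a strictly larger associated prime, containing [x], for $J+(x)$. *)
pose N u := forall p, colon J z p -> J (p * u).
have hN : is_id N.
  split=> [p _|a u v Nu Nv p pz']; first by rewrite mulr0; case: hJ.
  rewrite /GRing.scale /= mulrDr mulrCA; apply: is_idD => //; last exact: Nv.
  by apply: is_idMl => //; apply: Nu.
have [u Nu Jxu] : exists2 u, N u & ~ idadd J x u.
  apply: contrapT => noN; apply: Jz.
  have [s [sN Ns]] := noeth_fg noethR hN.
  have Nz : N z by [].
  move: (Ns z Nz); apply: (@local_nakayama R _ pm mu' R^o) => // y /sN Ny.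
  have [r Jr] : idadd J x y by apply: contrapT => h; apply: noN; exists y.
  have Nr : N r.
    move=> p pz'; apply: Jx.
    have -> : x * (p * r) = p * y - p * (y - r * x) by ring.
    by apply: is_idB => //; [exact: Ny | exact: is_idMl].
  suff : @lin R R^o (fun x => x \in m) J s ((y - r * x : R^o) + x *: (r : R^o)).
    by rewrite /GRing.scale /= [x * r]mulrC subrK.
  apply: is_subD; [exact: lin_sub | exact: lin_base |].
  by apply: lin_scale => //; apply: Ns.
have [w mw uw] := max_colon_exists noethR hJx Jxu.
have [|Q cQ] := IH (idadd J x) w hJx _ (proj1 mw) (max_colon_prime hJx mw).
  move=> i it; apply: ext_idadd => //; apply: van => //; exact: ltnW.
exists Q; split=> //; exists (colon (idadd J x) w); split=> //.
  by move=> p pz'; apply: uw; apply: idadd_sub; apply: Nu.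
by move=> h; apply: zx; apply: h; apply: is_idMr => //; apply: idadd_mem.
Qed.

Lemma chain_take (n k : nat) P Q : chain (n + k) P Q -> exists S, chain n P S.
Proof.
elim: n P => [|n IH] P; first by move=> /chain_prime pP; exists P.
by move=> [pP [P' [h1 h2 /IH[S c]]]]; exists S; split=> //; exists P'.
Qed.

Lemma zero_id : is_id (fun a : R => a = 0).
Proof. by split=> // a x y -> ->; rewrite scaler0 addr0. Qed.

(** If the sequence stops at length $r<d$, then [I] lies in an associated prime of $R/(y)$. Below
    that prime there is a chain of length [d], above it one of length [n - r]: together more than
    the dimension [n]. *)
Lemma height_grade (L : free_resolution (quotmod m)) (I : ideal R) d (s : seq R) :
  regs (fun a => a = 0) s -> (forall x : R, x \in s -> x \in m) ->
  (forall P Q, ~ chain (size s).+1 P Q) -> {subset I <= m} ->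
  (forall P, is_prime P -> (forall a : R, a \in I -> P a) -> exists P0, chain d P0 P) ->
  exists y : seq R, [/\ size y = d, forall x : R, x \in y -> x \in I & regs (fun a => a = 0) y].
Proof.
move=> rs sm nochain Im hI; set n := size s in nochain.
have noc k P Q : (n < k)%N -> ~ chain k P Q.
  by move=> nk; rewrite -(subnKC nk) => /chain_take[S]; apply: nochain.
have van i : (i < n)%N -> ext_vanishes L (fun a => a = 0) i.
  have sM (x : R) (v : quotmod m) : x \in s -> x *: v = 0.
    move=> /sm xm; have [p [ps pI]] := quot_pi m; have [w <-] := ps v.
    by rewrite -linearZ; apply/pI; apply: (is_idMr w (is_id_mem m)).
  exact: (ext_regs zero_id (fun x xs v => sM x v xs) rs).
have dn : (d <= n)%N.
  rewrite leqNgt; apply/negP => nd.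
  by have [P0 /(noc _ _ _ nd)] := hI _ pm Im.
suff: forall r, (r <= d)%N -> exists y : seq R, [/\ size y = r, forall x : R, x \in y -> x \in I
    & regs (fun a => a = 0) y] by apply.
elim=> [|r IH] rd; first by exists [::].
have [y [yr yI ry]] := IH (ltnW rd).
have hJ := adds_id y zero_id; set J := adds _ y in hJ.
have [[x Ix Jx]|[w [Jw pw Iw]]] := nzd_or_colon noethR hJ (is_id_mem I).
  exists (rcons y x); split; first by rewrite size_rcons yr.
    by move=> z; rewrite mem_rcons inE => /orP[/eqP->//|/yI].
  by apply/regs_rcons.
have [P0 c0] := hI _ pw Iw.
have [|Q cQ] := @chain_depth L (n - r) J w hJ _ Jw pw.
  apply: ext_adds => //; first exact: zero_id.
  by move=> i; rewrite yr subnK; [apply: van | apply: leq_trans dn; exact: ltnW].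
have := chain_cat c0 cQ => /noc []; lia.
Qed.

(** Dividing by [y] lowers the vanishing range to $\operatorname{Hom}(R/I,R/(y))=0$, so [I] contains
    one more nonzerodivisor and [regs_height] applies to $d+1$ elements. *)
Lemma grade_height (I : ideal R) (F : free_resolution (quotmod I)) d (y : seq R) :
  size y = d -> (forall x : R, x \in y -> x \in I) -> regs (fun a => a = 0) y ->
  (forall i, (i <= d)%N -> ext_vanishes F (fun a => a = 0) i) ->
  forall P, is_prime P -> (forall a : R, a \in I -> P a) -> exists P0, chain d.+1 P0 P.
Proof.
move=> yd yI ry van P pP IP.
have hJ := adds_id y zero_id; set J := adds _ y in hJ.
have vanJ : ext_vanishes F J 0.
  apply: (@ext_adds _ _ _ _ _ 1) => //; first exact: zero_id.
  by move=> i; rewrite yd => ?; apply: van.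
have [[x Ix Jx]|[w [Jw pw Iw]]] := nzd_or_colon noethR hJ (is_id_mem I); last first.
  by case: Jw; apply: ext0_quotmod vanJ _.
rewrite -yd -(size_rcons y x); apply: regs_height => //.
  by move=> z; rewrite mem_rcons inE => /orP[/eqP->|/yI]; apply: IP.
by apply/regs_rcons.
Qed.

Lemma spanned_image (M : lmodType R) (t : seq M) : exists f : {linear 'rV[R]_(size t) -> M},
  forall x, lspan t x <-> exists u, f u = x.
Proof.
have [|f fE] := linear_fun (f := fun u : 'rV[R]_(size t) => \sum_i u 0 i *: t`_i).
  move=> a u v; rewrite scaler_sumr -big_split; apply: eq_bigr => i _ /=.
  by rewrite !mxE scalerDl scalerA.
exists f => x; rewrite -in_spanE; split=> [[c ->]|[u <-]].
  by exists (\row_i c i); rewrite fE; apply: eq_bigr => i _; rewrite mxE.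
by exists (u 0); rewrite fE.
Qed.

(** The least rank [k] of a cover is taken: a relation with a unit coordinate would express one
    generator through the others. *)
Lemma minimal_cover (M : lmodType R) (A : M -> Prop) (t : seq M) :
  is_sub A -> (forall y, y \in t -> A y) -> (forall x, A x -> lspan t x) ->
  exists k (f : {linear 'rV[R]_k -> M}), (forall x, A x <-> exists u, f u = x) /\
    forall u, f u = 0 -> forall j, u 0 j \in m.
Proof.
move=> hA tA At.
pose cov k := `[< exists f : {linear 'rV[R]_k -> M}, forall x, A x <-> exists u, f u = x >].
have ecov : exists k, cov k.
  exists (size t); apply/asboolP; have [f fE] := spanned_image t; exists f => x.
  by rewrite -fE; split=> [/At|]//; apply: lspan_min.
case: (ex_minnP ecov) => k /asboolP[f fA] kmin; exists k, f; split=> // u fu j.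
apply: contraT => /mu[a au].
case: k f fA kmin u fu j au => [|k] f fA kmin u fu j au; first by case: j au.
(* Multiplication by [row' j 1%:M] inserts a zero at position [j], so [g] is [f] without its [j]-th
   generator. *)
have [|g gE] := linear_fun (f := fun v : 'rV[R]_k => f (v *m row' j 1%:M)).
  by move=> b v w; rewrite mulmxDl -scalemxAl linearP.
suff /kmin : cov k by rewrite ltnn.
apply/asboolP; exists g => x; split=> [/fA[w wx]|[v <-]]; last first.
  by rewrite gE; apply/fA; eexists.
have dropj (w' : 'rV[R]_k.+1) : w' 0 j = 0 -> col' j w' *m row' j 1%:M = w'.
  move=> w'j; apply/rowP => l; rewrite mxE.
  under eq_bigr do rewrite !mxE.
  case: (unliftP j l) => [i|] ->; last first.
    by rewrite w'j big1 // => i _; rewrite eq_sym (negPf (neq_lift _ _)) mulr0.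
  rewrite (bigD1 i) //= eqxx mulr1 big1 ?addr0 // => i' i'i.
  by rewrite (inj_eq (@fintype.lift_inj _ _)) (negPf i'i) mulr0.
exists (col' j (w - (w 0 j * a) *: u)); rewrite gE dropj.
  by rewrite linearB linearZ /= fu scaler0 subr0.
by rewrite !mxE -mulrA au mulr1 subrr.
Qed.

Lemma lspan_delta k (x : 'rV[R]_k) : lspan [seq (delta_mx 0 i : 'rV[R]_k) | i : 'I_k] x.
Proof.
rewrite [x]row_sum_delta; apply: is_sub_sum; first exact: lspan_sub.
by move=> i _; apply: is_subZ; [exact: lspan_sub | apply: lspan_mem; apply: image_f].
Qed.

Lemma kernel_cover k (M : lmodType R) (f : {linear 'rV[R]_k -> M}) :
  exists k' (g : {linear 'rV[R]_k' -> 'rV[R]_k}), (forall x, f x = 0 <-> exists u, g u = x) /\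
    forall u, g u = 0 -> forall j, u 0 j \in m.
Proof.
have hK : is_sub (fun x => f x = 0).
  by split=> [|a x y fx fy]; rewrite ?linear0 // linearP fx fy scaler0 addr0.
have [|t [tK Kt]] := noeth_sub_fg noethR (s := [seq (delta_mx 0 i : 'rV[R]_k) | i : 'I_k]) hK.
  by move=> x _; apply: lspan_delta.
exact: minimal_cover hK tK Kt.
Qed.

Lemma minimal_resolution_exists (M : lmodType R) :
  finitely_generated M -> exists F : free_resolution M, minimal m F.
Proof.
move=> [t tg].
have tT x : True -> lspan t x by move=> _; apply/in_spanE/tg.
have [//|//|k0 [e [eM em]]] := minimal_cover (A := fun=> True) _ _ tT.
pose X k k' := {linear 'rV[R]_k' -> 'rV[R]_k}.
have [||k [d [[e' [e'M e'd e'm]] dP]]] := @dependent_sequence nat X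
  (fun a b c f g => (forall x, f x = 0 <-> exists u, g u = x) /\
      forall u, g u = 0 -> forall j, u 0 j \in m)
  (fun a b f => exists e : {linear 'rV[R]_a -> M}, [/\ forall x, exists u, e u = x,
      forall x, e x = 0 <-> exists u, f u = x &
      (forall u, e u = 0 -> forall j, u 0 j \in m) /\
      forall u, f u = 0 -> forall j, u 0 j \in m]).
- by move=> a b f; apply: kernel_cover.
- have [k1 [f [fe fm]]] := kernel_cover e.
  by exists k0, k1, f, e; split=> // x; apply/eM.
have res : @is_resolution R M (fun i => 'rV[R]_(k i)) d e'.
  by split=> // i; apply: (dP i).1.
exists (FreeResolution res) => -[|i] y j /=.
  by apply: e'm.1; apply/e'd; exists y.
case: i y j => [|i] y j; last by apply: (dP i).2; apply/((dP i.+1).1); exists y.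
by apply: e'm.2; apply/((dP 0%N).1); exists y.
Qed.

Lemma rV_projective k : projective 'rV[R]_k.
Proof. by move=> U V g f gs; apply: lift_free => v; apply: gs. Qed.

Definition coords_in J k (u : 'rV[R]_k) : Prop := forall j, J (u 0 j).

Lemma coords_in_lin J k l (f : {linear 'rV[R]_k -> 'rV[R]_l}) u :
  is_id J -> coords_in J u -> coords_in J (f u).
Proof.
move=> hJ Ju j; rewrite [u]row_sum_delta linear_sum summxE.
have: is_sub (J : R^o -> Prop) by [].
move=> /(@is_sub_sum R R^o J); apply=> i _.
by rewrite linearZ mxE; apply: is_idMr.
Qed.

(* Tor_i(M, R/J) = 0 for i > j. *)
Definition tor_vanishes (M : lmodType R) (F : free_resolution M) J j : Prop :=
  forall i, (j <= i)%N -> forall u, coords_in J (bd F i u) ->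
    exists v, coords_in J (u - bd F i.+1 v).

(** $\operatorname{Tor}_i(M,R/(J,x))$ lies between $\operatorname{Tor}_i(M,R/J)$ and
    $\operatorname{Tor}_{i-1}(M,R/J)$; the second accounts for the degree lost. *)
Lemma tor_idadd (M : lmodType R) (F : free_resolution M) J x j : is_id J -> nzd J x ->
  tor_vanishes F J j -> tor_vanishes F (idadd J x) j.+1.
Proof.
move=> hJ Jx tor [//|i] ji u ux.
have [v vE] : exists v : 'rV[R]_(rk F i.+1), coords_in J (bd F i.+1 u - x *: v).
  exists (\row_l sval (cid (ux l))) => l; rewrite !mxE [x * _]mulrC.
  exact: (svalP (cid (ux l))).
have [|v' v'E] := tor i ji v.
  move=> l; apply: Jx.
  have := coords_in_lin (bd F i) hJ vE l.
  by rewrite linearB bdbd sub0r linearZ !mxE => /(is_idN hJ); rewrite opprK.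
have [|y yE] := tor i.+1 (leqW ji) (u - x *: v').
  move=> l; have := is_idD hJ (vE l) (is_idMl x hJ (v'E l)).
  have -> : bd F i.+1 (u - x *: v') = bd F i.+1 u - x *: bd F i.+1 v'.
    by rewrite linearB linearZ.
  by rewrite !mxE mulrBr addrA subrK.
exists y => l; exists (v' 0 l); have := yE l; rewrite !mxE.
by rewrite [x * _]mulrC addrAC.
Qed.

Lemma tor_regs (M : lmodType R) (F : free_resolution M) J s j : is_id J -> regs J s ->
  tor_vanishes F J j -> tor_vanishes F (adds J s) (j + size s).
Proof.
elim: s J j => [|x s IH] J j hJ /=; first by rewrite addn0.
move=> [Jx rs] tor; rewrite addnS -addSn; apply: IH => //; first exact: idadd_id.
exact: tor_idadd.
Qed.

(* Hilbert's syzygy theorem, through Tor_i(M, R/m) = 0 for i > dim R. *)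
Lemma minimal_resolution_finite (M : lmodType R) (F : free_resolution M) (s : seq R) :
  minimal m F -> regs (fun a => a = 0) s -> (forall a : R, adds (fun a => a = 0) s a <-> a \in m) ->
  forall i, (size s < i)%N -> rk F i = 0%N.
Proof.
move=> Fm rs sm [//|i] si; case rkE : (rk F i.+1) => [//|k].
have [_ m1 _] := pm; case: m1.
have tor : tor_vanishes F (adds (fun a => a = 0) s) (0 + size s).
  apply: tor_regs => //; first exact: zero_id.
  move=> j _ u u0; have [|v vE] := @bd_exact _ _ F j u; first by apply/rowP => l; rewrite mxE.
  by exists v => l; rewrite vE subrr mxE.
have pos : (0 < rk F i.+1)%N by rewrite rkE.
(* By minimality a basis vector is a cycle modulo [m], hence a boundary modulo [m]; boundaries have
   coordinates in [m] too, so 1 would lie in [m]. *)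
have [|v vE] := tor i si (delta_mx 0 (Ordinal pos)).
  by move=> l; apply/sm; apply: Fm.
have := vE (Ordinal pos); rewrite sm !mxE !eqxx /= => h.
by rewrite -[1](subrK (bd F i.+1 v 0 (Ordinal pos))); apply: (is_idD (is_id_mem m)) => //; apply: Fm.
Qed.

Lemma regular_finite_projdim (M : lmodType R) (s : seq R) :
  finitely_generated M ->
  regs (fun a => a = 0) s -> (forall a : R, adds (fun a => a = 0) s a <-> a \in m) ->
  finite_projdim M.
Proof.
move=> /minimal_resolution_exists[F Fm] rs sm.
exists (fun i => 'rV[R]_(rk F i)), (bd F), (aug F), (size s); split.
- exact: resolutionP.
- by move=> i; apply: rV_projective.
- move=> i si x; apply/rowP => j; exfalso.
  by case: j; rewrite (minimal_resolution_finite Fm rs sm si).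
Qed.

End LocalDepth.

(** * Syzygies and order ideals *)

Section Syzygies.
Variable R : comNzRingType.

Definition exact_at (U V W : lmodType R) (f : {linear U -> V}) (g : {linear V -> W}) :=
  forall v, g v = 0 <-> exists u, f u = v.

Definition onto (U V : lmodType R) (f : {linear U -> V}) := forall v, exists u, f u = v.

(* N is the kernel of some surjection of a finite free module onto M; no
   minimality is required. *)
Definition syz1 (M N : lmodType R) : Prop :=
  exists (V : vectType R) (g : {linear V -> M}) (j : {linear N -> V}),
    [/\ onto g, injective j & exact_at j g].

Fixpoint nsyz (i : nat) (M N : lmodType R) : Prop :=
  if i is i'.+1 then exists2 N', nsyz i' M N' & syz1 N' N else M = N.

Definition syz_incl (M : lmodType R) (F : free_resolution M) i :
  {linear syz F i.+1 -> 'rV[R]_(rk F i)} := incl (im_lin (bd F i)).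

Lemma syz_incl_inj M (F : free_resolution M) i : injective (@syz_incl M F i).
Proof. exact: incl_inj. Qed.

Lemma im_corestrict (U V : lmodType R) (f : {linear U -> V}) :
  exists g : {linear U -> submod (im_lin f)}, onto g /\ forall u, incl (im_lin f) (g u) = f u.
Proof.
have [|g gE] := lift_mono (@incl_inj _ _ (im_lin f)) (f := f).
  by move=> u; apply: incl_onto; apply/asboolP; exists u.
exists g; split=> // y; have /asboolP[u uy] := incl_mem y.
by exists u; apply: incl_inj; rewrite gE.
Qed.

Lemma im_incl_ex (U V : lmodType R) (f : {linear U -> V}) (y : submod (im_lin f)) :
  exists u, f u = incl (im_lin f) y.
Proof. by have /asboolP := incl_mem y. Qed.

Lemma im_inclP (U V : lmodType R) (f : {linear U -> V}) v :
  (exists y, incl (im_lin f) y = v) <-> exists u, f u = v.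
Proof.
split=> [[y <-]|[u uv]]; first by have /asboolP := incl_mem y.
by apply: incl_onto; apply/asboolP; exists u.
Qed.

Lemma syz_coverS M (F : free_resolution M) i :
  exists g : {linear 'rV[R]_(rk F i.+1) -> syz F i.+1},
    onto g /\ forall u, syz_incl F i (g u) = bd F i u.
Proof. exact: im_corestrict. Qed.

Lemma syz_cover M (F : free_resolution M) i :
  exists g : {linear 'rV[R]_(rk F i) -> syz F i}, onto g /\ exact_at (syz_incl F i) g.
Proof.
case: i => [|i].
  exists (aug F); split; first exact: aug_onto.
  move=> v; rewrite im_inclP; split; first exact: aug_exact.
  by move=> [u <-]; rewrite augbd.
have [g [gs gE]] := syz_coverS F i; exists g; split=> // v.
rewrite im_inclP; split=> [g0|[u uv]].
  by apply: bd_exact; rewrite -gE g0 linear0.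
by apply: (@syz_incl_inj _ F i); rewrite gE -uv bdbd linear0.
Qed.

Lemma nsyz_compare M (F : free_resolution M) i N : nsyz i M N ->
  exists (V : vectType R) (al : {linear syz F i -> N}) (be : {linear N -> syz F i})
    (s : {linear N -> V}) (t : {linear V -> N}), forall n, n - al (be n) = t (s n).
Proof.
elim: i N => [|i IH] N /=.
  move=> <-; exists 'rV[R]_0, (lid M), (lid M), \0, \0 => n /=.
  by rewrite subrr.
move=> [N' /IH[V0 [al [be [s0 [t0 st0]]]]] [V [g1 [j1 [g1s j1i j1g1]]]]].
have [g [gs gj]] := syz_cover F i.
have g1j1 n : g1 (j1 n) = 0 by apply/j1g1; exists n.
have gj0 y : g (syz_incl F i y) = 0 by apply/gj; exists y.
have [|A AE] := lift_free (g := g1) (f := lcomp al g); first by move=> v; apply: g1s.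
have [|B BE] := lift_free (g := g) (f := lcomp be g1); first by move=> v; apply: gs.
have [|al' al'E] := lift_mono j1i (f := lcomp A (syz_incl F i)).
  by move=> y; apply/j1g1; rewrite /= AE /= gj0 linear0.
have [|be' be'E] := lift_mono (@syz_incl_inj _ F i) (f := lcomp B j1).
  by move=> y; apply/gj; rewrite /= BE /= g1j1 linear0.
have [|T TE] := lift_free (g := g1) (f := t0); first by move=> v; apply: g1s.
(* On [N'] the error is [t0 s0], that is [g1 T s0], so [id - A B - T s0 g1] maps [V] into the kernel
   of [g1]. The last term vanishes on [N]. *)
have [|s' s'E] := lift_mono j1i
    (f := lsub (lsub (lid V) (lcomp A B)) (lcomp T (lcomp s0 g1))).
  move=> v; apply/j1g1; rewrite /= !linearB /= AE /= BE /= TE -st0.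
  by rewrite subrr.
exists V, al', be', j1, s' => n; apply: j1i.
by rewrite s'E linearB al'E /= be'E /= g1j1 !linear0 addr0.
Qed.

Lemma extend_vect (A U : lmodType R) (j : {linear A -> U}) (V : vectType R) :
  (forall phi : {linear A -> R^o}, exists psi : {linear U -> R^o},
     forall a, psi (j a) = phi a) ->
  forall phi : {linear A -> V}, exists psi : {linear U -> V}, forall a, psi (j a) = phi a.
Proof.
move=> ext phi.
have ex k : {psi : {linear U -> R^o} | forall a, psi (j a) = v2r (phi a) 0 k}.
  apply: cid.
  have [|f fE] := linear_fun (f := fun a => v2r (phi a) 0 k : R^o).
    by move=> c a b; rewrite !linearP !mxE.
  by have [psi psiE] := ext f; exists psi => a; rewrite psiE fE.
have [|psi psiE] := linear_fun (f := fun u => \sum_k sval (ex k) u *: (r2v (delta_mx 0 k) : V)).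
  move=> c a b; rewrite scaler_sumr -big_split; apply: eq_bigr => i _.
  by rewrite linearP scalerDl scalerA.
exists psi => a; rewrite psiE [RHS]vect_basisE.
by apply: eq_bigr => k _; rewrite (svalP (ex k)).
Qed.

(** Dimension shifting:
    $\operatorname{Ext}^{i+1}(M,R)=\operatorname{Ext}^1(\operatorname{Syz}^i(M),R)$, whose vanishing
    is this extension property. *)
Lemma syz_extend M (F : free_resolution M) i (V : vectType R) :
  ext_vanishes F (fun a => a = 0) i.+1 ->
  forall phi : {linear syz F i.+1 -> V}, exists psi : {linear 'rV[R]_(rk F i) -> V},
    forall a, psi (syz_incl F i a) = phi a.
Proof.
move=> van; apply: extend_vect => phi.
have [g [gs gE]] := syz_coverS F i.
have [|psi psiE] := van (lcomp phi g).
  move=> u; rewrite /= [g _](_ : _ = 0) ?linear0 //.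
  by apply: (@syz_incl_inj _ F i); rewrite gE bdbd linear0.
exists psi => a; have [u <-] := gs a.
by rewrite gE; apply/eqP; rewrite eq_sym -subr_eq0; apply/eqP/psiE.
Qed.

(* In the last clause the extension of linear maps says that Ext^1(C, V) = 0, and
   a linear map restricting to a on B says that a kills the class of the
   extension Z of C by B. *)
Lemma horseshoe (B Z C B' C' : lmodType R) (V U : vectType R)
    (i : {linear B -> Z}) (p : {linear Z -> C})
    (f : {linear V -> B}) (jb : {linear B' -> V})
    (g : {linear U -> C}) (jc : {linear C' -> U}) :
  injective i -> onto p -> exact_at i p -> onto f -> injective jb -> exact_at jb f ->
  onto g -> injective jc -> exact_at jc g ->
  exists (Z' : lmodType R) (i' : {linear B' -> Z'}) (p' : {linear Z' -> C'})
    (th : {linear Z' -> V}),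
    [/\ syz1 Z Z', [/\ injective i', onto p' & exact_at i' p'],
        forall b, th (i' b) = jb b &
        (forall phi : {linear C' -> V}, exists psi : {linear U -> V},
           forall c, psi (jc c) = phi c) ->
        forall a, (exists psi : {linear Z' -> B'}, forall b, psi (i' b) = a *: b) ->
          exists psi : {linear Z -> B}, forall b, psi (i b) = a *: b].
Proof.
move=> iI ps ip fs jbI jbf gs jcI jcg.
have fjb b : f (jb b) = 0 by apply/jbf; exists b.
have gjc b : g (jc b) = 0 by apply/jcg; exists b.
have pi0 b : p (i b) = 0 by apply/ip; exists b.
have [|h hE] := lift_free (g := p) (f := g); first by move=> v; apply: ps.
have [|q qE] := linear_fun (f := fun x : V * U => i (f x.1) + h x.2).
  by move=> a x y /=; rewrite !linearP scalerDr addrACA.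
have qs : onto q.
  move=> z; have [u uz] := gs (p z).
  have [|b bz] := (ip (z - h u)).1; first by rewrite linearB hE uz subrr.
  by have [v vb] := fs b; exists (v, u); rewrite qE /= vb bz subrK.
have [|S SE] := sub_exists (A := fun x => q x = 0).
  by split=> [|a x y x0 y0]; rewrite ?linear0 // linearP x0 y0 scaler0 addr0.
have qK : exact_at (incl S) q.
  move=> x; split=> [x0|[z <-]]; last by apply/asboolP; rewrite -SE; apply: incl_mem.
  by apply: incl_onto; rewrite SE; apply/asboolP.
have [|fst_ fstE] := linear_fun (f := fun x : V * U => x.1); first by [].
have [|snd_ sndE] := linear_fun (f := fun x : V * U => x.2); first by [].
have [|jb' jb'E] := linear_fun (f := fun b => (jb b, 0 : U)).
  by move=> a x y; rewrite linearP; congr (_, _); rewrite addr0; symmetry; apply: scaler0.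
have [|i' i'E] := lift_mono (@incl_inj _ _ S) (f := jb').
  by move=> b; apply/qK; rewrite qE jb'E /= fjb !linear0 addr0.
have [|p' p'E] := lift_mono jcI (f := lcomp snd_ (incl S)).
  move=> z; apply/jcg; rewrite /= sndE -hE.
  have /qK : exists y, incl S y = incl S z by exists z.
  rewrite qE => /eqP; rewrite addr_eq0 => /eqP/(congr1 p).
  by rewrite pi0 linearN => /eqP; rewrite eq_sym oppr_eq0 => /eqP.
exists (submod S), i', p', (lcomp fst_ (incl S)); split.
- by exists (V * U)%type, q, (incl S); split=> //; apply: incl_inj.
- split.
  + move=> x y xy; apply: jbI.
    by have := congr1 (fun z => (incl S z).1) xy; rewrite !i'E !jb'E.
  + move=> c; have [|b bE] := (ip (h (jc c))).1; first by rewrite hE gjc.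
    have [v vb] := fs b.
    have [|z zE] := (qK (- v, jc c)).1.
      by rewrite qE /= !linearN vb bE addNr.
    by exists z; apply: jcI; rewrite p'E /= sndE zE.
  + move=> z; split=> [z0|[b <-]]; last first.
      by apply: jcI; rewrite p'E /= sndE i'E jb'E linear0.
    have u0 : (incl S z).2 = 0 by rewrite -sndE -[snd_ _]p'E z0 linear0.
    have [|b bE] := (jbf (incl S z).1).1.
      have /qK : exists y, incl S y = incl S z by exists z.
      by rewrite qE u0 linear0 addr0 -[RHS](linear0 i) => /iI.
    exists b; apply: incl_inj; rewrite i'E jb'E bE -u0.
    by case: (incl S z).
- by move=> b; rewrite /= fstE i'E jb'E.
move=> ext a [psi psiE].
(* The difference [jb psi - a fst] vanishes on [B'], so it comes from [C'] and extends to [t] on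
   [U]. Then [a fst + t snd] equals [jb psi] on the kernel of [q], and composing with [f] makes it
   descend to [Z]. *)
have [||t0 t0E] := factor_surj (f := p')
    (k := lsub (lcomp jb psi) (lscale a (lcomp fst_ (incl S)))).
- move=> c; have [|b bE] := (ip (h (jc c))).1; first by rewrite hE gjc.
  have [v vb] := fs b.
  have [|z zE] := (qK (- v, jc c)).1; first by rewrite qE /= !linearN vb bE addNr.
  by exists z; apply: jcI; rewrite p'E /= sndE zE.
- move=> z z0 /=.
  have u0 : (incl S z).2 = 0 by rewrite -sndE -[snd_ _]p'E z0 linear0.
  have [|b bE] := (jbf (incl S z).1).1.
    have /qK : exists y, incl S y = incl S z by exists z.
    by rewrite qE u0 linear0 addr0 -[RHS](linear0 i) => /iI.
  have -> : z = i' b.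
    by apply: incl_inj; rewrite i'E jb'E bE -u0; case: (incl S z).
  by rewrite psiE fstE i'E jb'E linearZ subrr.
have [t tE] := ext t0.
have [||k kE] := factor_surj (f := q)
    (k := lcomp f (ladd (lscale a fst_) (lcomp t snd_))).
- exact: qs.
- move=> x /qK[z <-] /=; rewrite -[snd_ _]p'E tE t0E /= addrC subrK fjb //.
exists k => b; have [v <-] := fs b.
have <- : q (v, 0) = i (f v) by rewrite qE /= linear0 addr0.
by rewrite kE /= fstE sndE /= linear0 addr0 linearZ.
Qed.

Lemma free_summand_of_functional (N : lmodType R) (chi : {linear N -> R^o}) x :
  chi x = 1 -> has_free_summand N.
Proof.
move=> x1.
have [|S SE] := sub_exists (A := fun x => chi x = 0).
  by split=> [|a u v u0 v0]; rewrite ?linear0 // linearP u0 v0 scaler0 addr0.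
have [|sx sxE] := linear_fun (f := fun c : R^o => c *: x).
  by move=> a c c'; rewrite scalerDl -scalerA.
have [|r rE] := lift_mono (@incl_inj _ _ S) (f := lsub (lid N) (lcomp sx chi)).
  move=> n; apply: incl_onto; rewrite SE; apply/asboolP.
  by rewrite /= sxE linearB linearZ /= x1 [_ *: _]mulr1 subrr.
have [|f fE] := linear_fun (f := fun n => (chi n, r n) : R^o * submod S).
  by move=> a u v; rewrite !linearP.
exists (submod S), f; exists (fun y => y.1 *: x + incl S y.2) => [n|[c y]].
  by rewrite fE /= rE /= sxE addrC subrK.
have chiy : chi (incl S y) = 0.
  by apply/asboolP; rewrite -SE; apply: incl_mem.
have cE : chi (c *: x + incl S y) = c by rewrite linearP x1 chiy addr0 [_ *: _]mulr1.
rewrite fE /= cE; congr (_, _); apply: incl_inj; rewrite rE /= sxE cE.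
by rewrite addrC addKr.
Qed.

End Syzygies.

Section OrderIdeals.
Variables (R : comNzRingType) (m : ideal R).
Hypothesis noethR : noetherian R.
Hypothesis pm : is_prime (fun x : R => x \in m).
Hypothesis mu : forall t : R, t \notin m -> exists u : R, u * t = 1.

(* x belongs to m N, the smallest submodule containing the products c y. *)
Definition in_mN (N : lmodType R) (x : N) : Prop :=
  forall A : N -> Prop, is_sub A -> (forall c y, c \in m -> A (c *: y)) -> A x.

Lemma in_mN_sub (N : lmodType R) : is_sub (@in_mN N).
Proof.
split=> [A [h0 _] _ //|a x y Ax Ay A hA mA].
by case: (hA) => _; apply; [apply: Ax | apply: Ay].
Qed.

Lemma in_mN_scale (N : lmodType R) c (y : N) : c \in m -> in_mN (c *: y).
Proof. by move=> cm A hA mA; apply: mA. Qed.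

Lemma in_mN_lin (N N' : lmodType R) (f : {linear N -> N'}) x : in_mN x -> in_mN (f x).
Proof.
move=> xm A hA mA; apply: (xm (fun x => A (f x))).
  split; first by rewrite linear0; case: hA.
  by move=> a y z Ay Az; rewrite linearP; case: (hA) => _; apply.
by move=> c y cm; rewrite linearZ; apply: mA.
Qed.

(** As [b] is not in $mN$, one of its coefficients on [t] is a unit, and [b] can replace that
    generator. *)
Lemma exchange (N : lmodType R) (t : seq N) b : ~ in_mN b -> lspan t b ->
  exists t1, (size t1).+1 = size t /\ forall y, y \in t -> lspan (b :: t1) y.
Proof.
elim: t b => [|g t IH] b bm /=; first by move=> b0; case: bm; rewrite b0; case: (in_mN_sub N).
move=> [c bc]; have [cm|/mu[u uc]] := boolP (c \in m).
  have [||t1 [t1s t1t]] := IH (b - c *: g).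
  - move=> h; apply: bm; rewrite -[b](subrK (c *: g)).
    by apply: (is_subD (@in_mN_sub N)) => //; apply: in_mN_scale.
  - by [].
  exists (g :: t1); split; first by rewrite /= t1s.
  have hs := lspan_sub (b :: g :: t1).
  have gs : lspan (b :: g :: t1) g by apply: lspan_mem; rewrite !inE eqxx orbT.
  move=> y; rewrite inE => /orP[/eqP->//|/t1t]; apply: (lspan_min hs) => z.
  rewrite inE => /orP[/eqP->|zt1]; last by apply: lspan_mem; rewrite !inE zt1 !orbT.
  apply: (is_subB hs); first by apply: lspan_mem; rewrite mem_head.
  exact: (is_subZ _ hs).
exists t; split=> // y; have hs := lspan_sub (b :: t).
have ts z : lspan t z -> lspan (b :: t) z by exists 0; rewrite scale0r subr0.
rewrite inE => /orP[/eqP->|/lspan_mem/ts//].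
have -> : g = u *: (b - (b - c *: g)) by rewrite subKr scalerA uc scale1r.
apply: (is_subZ _ hs); apply: (is_subB hs); last exact: ts.
by apply: lspan_mem; rewrite mem_head.
Qed.

(** The shortest [s] with [b :: s] generating is chosen. A subfamily keeping [b] cannot be shorter;
    one dropping [b] could be shortened by exchanging [b] for a generator. *)
Lemma minimal_generator_of_notin (N : lmodType R) (t : seq N) (b : N) :
  generates t -> ~ in_mN b -> minimal_generator b.
Proof.
move=> tg bm.
have gE (s : seq N) : generates s <-> forall x, lspan s x.
  by split=> h x; apply/in_spanE.
pose ok n := `[< exists2 s : seq N, size s = n & generates (b :: s) >].
have eok : exists n, ok n.
  exists (size t); apply/asboolP; exists t => //; apply/gE => x.
  by exists 0; rewrite scale0r subr0; apply/in_spanE.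
case: (ex_minnP eok) => n /asboolP[s sn sg] nmin.
exists (b :: s); last exact: mem_head.
split=> // -[|a t1] ts t1g.
  case: bm; have /gE /(_ b) /= -> := t1g; by case: (in_mN_sub N).
move: ts => /=; case: eqP => [ab|_] ts.
  rewrite ab in t1g *; congr (_ :: _).
  have le : (size s <= size t1)%N.
    by rewrite sn; apply: nmin; apply/asboolP; exists t1.
  by have := size_subseq_leqif ts => -[le2]; rewrite eqn_leq le2 le => /esym/eqP.
have [t2 [t2s t2t]] := exchange bm ((gE _).1 t1g b).
have : ok (size t2).
  apply/asboolP; exists t2 => //; apply/gE => x.
  have /gE/(_ x) := t1g; apply: (lspan_min (lspan_sub _)) => //.
move=> /nmin; rewrite -sn; have := size_subseq ts; rewrite -t2s => h1 h2.
by have := leq_trans h1 h2; rewrite ltnn.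
Qed.

Lemma syz_finitely_generated (M : lmodType R) (F : free_resolution M) i :
  finitely_generated (syz F i).
Proof.
have [g [gs _]] := syz_cover F i.
exists [seq g (delta_mx 0 k) | k : 'I_(rk F i)] => y; have [u <-] := gs y.
apply/in_spanE; rewrite [u]row_sum_delta linear_sum; apply: is_sub_sum.
  exact: lspan_sub.
move=> k _; rewrite linearZ; apply: is_subZ; first exact: lspan_sub.
by apply: lspan_mem; apply: image_f.
Qed.

Lemma grade_ge_mono (J K : ideal R) i : {subset J <= K} -> grade_ge J i -> grade_ge K i.
Proof.
move=> JK [/JK|[s [si sJ rs]]]; first by left.
by right; exists s; split=> // x /sJ/JK.
Qed.

(* The order ideal conjecture for arbitrary, not necessarily minimal, syzygies. *)
Lemma order_ideal_nsyz (M N : lmodType R) i (b : N) :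
  order_ideal_conjecture m -> finitely_generated M -> finite_projdim M ->
  (0 < i)%N -> nsyz i M N -> ~ in_mN b -> grade_ge (order_ideal b) i.
Proof.
move=> oic Mfg Mfpd i0 MN bm.
have [F Fm] := minimal_resolution_exists noethR mu Mfg.
have [V [al [be [s [t st]]]]] := nsyz_compare F MN.
(* If [be b] is part of a minimal system of generators, its functionals pull back along [be].
   Otherwise [b] agrees with [t (s b)] modulo $mN$, so [s b] has a unit coordinate and the order
   ideal is the unit ideal. *)
have [bbm|bbm] := pselect (in_mN (be b)); last first.
  have [w wg] := syz_finitely_generated F i.
  have := oic _ Mfg Mfpd F Fm i i0 _ (minimal_generator_of_notin wg bbm).
  apply: grade_ge_mono => a /asboolP[f <-]; apply/asboolP.
  by exists (lcomp f be).
left.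
have sbm : ~ in_mN (s b).
  move=> /(in_mN_lin t); rewrite -st => h; apply: bm.
  rewrite -[b](subrK (al (be b))); apply: (is_subD (@in_mN_sub N)) => //.
  exact: in_mN_lin.
have [k km] : exists k, v2r (s b) 0 k \notin m.
  apply: contrapT => nok; apply: sbm; rewrite [s b]vect_basisE.
  apply: (is_sub_sum _ (@in_mN_sub V)) => k _; apply: in_mN_scale; apply: contraT => km; case: nok.
  by exists k.
have [u uk] := mu km.
have [|f fE] := linear_fun (f := fun n => u * v2r (s n) 0 k : R^o).
  by move=> a x y; rewrite !linearP !mxE mulrDr mulrCA.
by apply/asboolP; exists f; rewrite fE.
Qed.

End OrderIdeals.

(** * The dual of a resolution *)

Section Duals.
Variable R : comNzRingType.

Definition dual k : vectType R := 'Hom('rV[R]_k, R^o).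

Definition ev k (phi : dual k) : {linear 'rV[R]_k -> R^o} :=
  fun_of_lfun (phi : 'Hom('rV[R]_k, R^o)).

Definition mkdual k (f : {linear 'rV[R]_k -> R^o}) : dual k := linfun f.

Lemma ev_mkdual k (f : {linear 'rV[R]_k -> R^o}) x : ev (mkdual f) x = f x.
Proof. exact: lfunE. Qed.

Lemma ev_inj k (phi psi : dual k) : (forall x, ev phi x = ev psi x) -> phi = psi.
Proof. by move=> h; apply/(@lfunP _ _ _ phi psi). Qed.

Lemma evD k (phi psi : dual k) x : ev (phi + psi) x = ev phi x + ev psi x.
Proof. exact: (@add_lfunE R _ _ phi psi). Qed.

Lemma evZ k a (phi : dual k) x : ev (a *: phi) x = a * ev phi x.
Proof. exact: (@scale_lfunE R _ _ a phi). Qed.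

Lemma evP k a (phi psi : dual k) x : ev (a *: phi + psi) x = a * ev phi x + ev psi x.
Proof. by rewrite evD evZ. Qed.

Lemma ev0 k x : ev (0 : dual k) x = 0.
Proof. by rewrite -(scale0r (0 : dual k)) evZ mul0r. Qed.

Lemma evB k (phi psi : dual k) x : ev (phi - psi) x = ev phi x - ev psi x.
Proof. by rewrite evD -scaleN1r evZ mulN1r. Qed.

Lemma dual_bd_exists (M : lmodType R) (F : free_resolution M) :
  exists dl : forall i, {linear dual (rk F i) -> dual (rk F i.+1)},
    forall i phi x, ev (dl i phi) x = ev phi (bd F i x).
Proof.
suff h i : {f : {linear dual (rk F i) -> dual (rk F i.+1)} |
    forall phi x, ev (f phi) x = ev phi (bd F i x)}.
  by exists (fun i => sval (h i)) => i; apply: (svalP (h i)).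
apply: cid.
have [|f fE] := linear_fun (f := fun phi : dual (rk F i) =>
    mkdual (lcomp (ev phi) (bd F i))).
  by move=> a phi psi; apply: ev_inj => x; rewrite evP !ev_mkdual /lcomp /= evP.
by exists f => phi x; rewrite fE ev_mkdual.
Qed.

Lemma bidual k (eta : {linear dual k -> R^o}) :
  exists f : 'rV[R]_k, forall phi, eta phi = ev phi f.
Proof.
have co l : {g : {linear 'rV[R]_k -> R^o} | forall u, g u = u 0 l}.
  apply: cid; have [|g gE] := linear_fun (f := fun u : 'rV[R]_k => u 0 l : R^o).
    by move=> a u v; rewrite !mxE.
  by exists g.
exists (\row_l eta (mkdual (sval (co l)))) => phi.
have -> : phi = \sum_l ev phi (delta_mx 0 l) *: mkdual (sval (co l)).
  apply: ev_inj => u; rewrite {1}[u]row_sum_delta linear_sum.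
  elim/big_ind2: _ => [|x1 x2 y1 y2 e1 e2|l _]; first by rewrite ev0.
    by rewrite evD -e1 -e2.
  by rewrite evZ ev_mkdual (svalP (co l)) linearZ /GRing.scale /= mulrC.
rewrite linear_sum; elim/big_ind2: _ => [|x1 x2 y1 y2 e1 e2|l _]; first by rewrite ev0.
  by rewrite evD -e1 -e2.
by rewrite linearZ evZ ev_mkdual (svalP (co l)) mxE.
Qed.

Definition cocycles (M : lmodType R) (F : free_resolution M) i :
  submodClosed (dual (rk F i)) := Defs_cocycle__canonical__GRing_SubmodClosed F i.

Definition coboundaries (M : lmodType R) (F : free_resolution M) i :
  submodClosed (submod (cocycles F i)) :=
  Defs_coboundary__canonical__GRing_SubmodClosed F i.

Lemma cocycle0 (M : lmodType R) (F : free_resolution M) i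
    (z : submod (cocycles F i)) x : ev (incl (cocycles F i) z) (bd F i x) = 0.
Proof. by have /asboolP := incl_mem z; apply. Qed.

Lemma cocycleI (M : lmodType R) (F : free_resolution M) i (phi : dual (rk F i)) :
  (forall x, ev phi (bd F i x) = 0) -> exists z, incl (cocycles F i) z = phi.
Proof. by move=> h; apply: incl_onto; apply/asboolP. Qed.

Lemma ext_presentation (M : lmodType R) (F : free_resolution M) d (Omega : lmodType R) :
  lmod_iso Omega (ext F d) ->
  exists p : {linear submod (cocycles F d) -> Omega},
    onto p /\ forall z, p z = 0 <-> is_coboundary (incl (cocycles F d) z).
Proof.
rewrite (_ : ext F d = quotmod (coboundaries F d)) // => -[f fb].
have [q [qs qK]] := quot_pi (coboundaries F d).
have [|p pE] := lift_mono (bij_inj fb) (f := q).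
  by move=> z; have [g _ gK] := fb; exists (g (q z)); rewrite gK.
exists p; split=> [w|z].
  by have [z zw] := qs (f w); exists z; apply: (bij_inj fb); rewrite pE.
have pq : (p z = 0) <-> (q z = 0).
  rewrite -pE; split=> [->|h]; first by rewrite linear0.
  by apply: (bij_inj fb); rewrite h linear0.
rewrite inclE; split=> [/pq/qK/asboolP //|h].
by apply/pq/qK; apply/asboolP.
Qed.

(** Multiplication by [x] is null-homotopic on [F], so [x] times a cocycle is the coboundary of that
    cocycle composed with [s]. *)
Lemma ext_killed (M : lmodType R) (F : free_resolution M) k (Omega : lmodType R) x :
  lmod_iso Omega (ext F k.+1) -> (forall v : M, x *: v = 0) ->
  forall w : Omega, x *: w = 0.
Proof.
move=> /ext_presentation[p [ps pK]] xM w; have [z <-] := ps w.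
rewrite -linearZ; apply/pK.
have [s sE] := homotopy F k xM.
exists (mkdual (lcomp (ev (incl (cocycles F k.+1) z)) s)) => u.
rewrite linearZ -[LHS]/(ev _ u) evZ -[RHS]/(ev _ _) ev_mkdual /lcomp /=.
have [v vE] := homotopyS u sE.
transitivity (ev (incl (cocycles F k.+1) z) (x *: u)); first by rewrite linearZ.
by rewrite vE linearD cocycle0 addr0.
Qed.

End Duals.

(** * The dual syzygy as an extension *)

Section MainConstruction.
Variables (R : comNzRingType) (M Omega : lmodType R).
Variables (F : free_resolution M) (L : free_resolution Omega).
Let zero := fun a : R => a = 0.
Notation D i := (dual R (rk F i)).
Variable dl : forall i, {linear D i -> D i.+1}.
Hypothesis dlE : forall i phi x, ev (dl i phi) x = ev phi (bd F i x).

Lemma dldl i phi : dl i.+1 (dl i phi) = 0.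
Proof. by apply: ev_inj => x; rewrite !dlE bdbd linear0 ev0. Qed.

Lemma dl_exact i phi : ext_vanishes F zero i.+1 -> dl i.+1 phi = 0 ->
  exists psi, dl i psi = phi.
Proof.
move=> van phi0; have [|psi psiE] := van (ev phi).
  by move=> u; rewrite -dlE phi0 ev0.
exists (mkdual psi); apply: ev_inj => x; rewrite dlE ev_mkdual.
by apply/eqP; rewrite eq_sym -subr_eq0; apply/eqP/psiE.
Qed.

Lemma dl0_inj : ext_vanishes F zero 0 -> injective (dl 0).
Proof.
move=> van phi psi e; apply/eqP; rewrite -subr_eq0; apply/eqP/ev_inj => x.
rewrite ev0; apply: (van (ev (phi - psi))) => u.
by rewrite -dlE linearB e subrr ev0.
Qed.

Notation B k := (submod (im_lin (dl k))).

(* Iterating the horseshoe lemma on 0 -> B^d -> Z^d -> Omega -> 0, where Z^d and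
   B^d are the d-cocycles and d-coboundaries of Hom(F, R). The last clause holds
   because the connecting maps leading to Ext^1(syz L e, B) are injective. *)
Lemma dual_syzygy d : lmod_iso Omega (ext F d) ->
  (forall i, (i < d)%N -> ext_vanishes F zero i) ->
  (forall i, (i < d)%N -> ext_vanishes L zero i) ->
  forall e k, d = (k + e).+1 ->
  exists (Z : lmodType R) (i : {linear B k -> Z}) (p : {linear Z -> syz L e})
    (th : {linear Z -> D k.+1}),
    [/\ nsyz e.+2 (quotmod (im_lin (dl d))) Z,
        [/\ injective i, onto p & exact_at i p],
        forall b, th (i b) = incl (im_lin (dl k)) b &
        forall a, (exists psi : {linear Z -> B k}, forall b, psi (i b) = a *: b) ->
          forall w : Omega, a *: w = 0].
Proof.
move=> iso vanF vanL; elim=> [|e IH] k dE.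
  rewrite addn0 in dE; subst d.
  have [p [ps pK]] := ext_presentation iso.
  have [|i iE] := lift_mono (@incl_inj _ _ (cocycles F k.+1)) (f := incl (im_lin (dl k))).
    move=> b; apply: cocycleI => x; have [psi <-] := im_incl_ex b.
    by rewrite -dlE dldl ev0.
  have pi0 : exact_at i p.
    move=> z; rewrite pK /=; split=> [[psi psiE]|[b <-]].
      have /im_inclP[b bE] : exists psi', dl k psi' = dl k psi by exists psi.
      exists b; apply: incl_inj; rewrite iE bE; apply: ev_inj => x.
      by rewrite dlE; symmetry; apply: psiE.
    have [psi psiE] := im_incl_ex b.
    by exists psi => x; rewrite iE -psiE; apply: dlE.
  exists (submod (cocycles F k.+1)), i, p, (incl _); split.
  (* The first syzygy of $W$ is the image of $D_d\to D_{d+1}$, and the kernel of $D_d$ onto that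
     image consists of the cocycles: they form a second syzygy of $W$. *)
  - have [g [gs gE]] := im_corestrict (dl k.+1).
    exists (submod (im_lin (dl k.+1))).
      exists (quotmod (im_lin (dl k.+1))) => //.
      have [q [qs qK]] := quot_pi (im_lin (dl k.+1)).
      exists (D k.+2), q, (incl _); split=> //; first exact: incl_inj.
      by move=> v; rewrite qK im_inclP; split=> [/asboolP//|?]; apply/asboolP.
    exists (D k.+1), g, (incl _); split=> //; first exact: incl_inj.
    move=> v; split=> [g0|[z <-]].
      apply: cocycleI => x.
      by rewrite -dlE -gE g0 linear0 ev0.
    by apply: incl_inj; rewrite gE linear0; apply: ev_inj => x; rewrite dlE cocycle0 ev0.
  - by split=> //; move=> x y xy; apply: incl_inj; rewrite -!iE xy.
  - exact: iE.
  move=> a [psi psiE] w.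
  have [||eta etaE] := factor_surj (f := p)
      (k := lsub (lcomp (incl _) psi) (lscale a (incl _))).
  - exact: ps.
  - by move=> z /pi0[b <-] /=; rewrite psiE iE linearZ subrr.
  (* Since $\operatorname{Hom}(\Omega,R)=0$, [psi] is multiplication by [a] on all cocycles, which
     makes [a z] a coboundary. *)
  have eta0 v : eta v = 0.
    apply: ev_inj => x; rewrite ev0.
    have [|phi phiE] := linear_fun (f := fun u : 'rV[R]_(rk L 0) => ev (eta (aug L u)) x : R^o).
      by move=> c u u'; rewrite !linearP evP.
    have [u <-] := aug_onto L v; rewrite -phiE.
    by apply: (vanL 0%N isT) => u'; rewrite phiE augbd linear0 ev0.
  have [z <-] := ps w; rewrite -linearZ; apply/pi0.
  exists (psi z); apply: incl_inj; rewrite iE linearZ.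
  by apply/eqP; rewrite -subr_eq0; apply/eqP; have := etaE z; rewrite eta0 => /esym.
have [|Z [i [p [th [MZ [iI ps ip] thE retr]]]]] := IH k.+1; first by rewrite dE addnS.
have [f [fs fE]] := im_corestrict (dl k.+1).
have [g [gs gE]] := syz_cover L e.
have vF : ext_vanishes F zero k.+1 by apply: vanF; rewrite dE addnS ltnS ltnS leq_addr.
have ft : exact_at (incl (im_lin (dl k))) f.
  move=> v; rewrite im_inclP; split=> [f0|[psi <-]].
    by apply: dl_exact => //; rewrite -fE f0 linear0.
  by apply: incl_inj; rewrite fE dldl linear0.
have [Z' [i' [p' [th' [ZZ' ex' th'E retr']]]]] :=
  horseshoe iI ps ip fs (@incl_inj _ _ _) ft gs (@syz_incl_inj _ _ L e) gE.
exists Z', i', p', th'; split=> //; first by exists Z.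
(* $\operatorname{Ext}^{e+1}(\Omega,R)=0$ because [e.+1 < d]; this is the injectivity of the
   connecting map at this step. *)
move=> a /retr' h; apply: retr; apply: h; apply: syz_extend; apply: vanL.
by rewrite dE ltnS addnS ltnS leq_addl.
Qed.

End MainConstruction.

(** * Regular local rings *)

Section RegularLocal.
Variable R : comNzRingType.
Implicit Types P Q : R -> Prop.

Definition inI (J : ideal R) : R -> Prop := fun x => x \in J.

Lemma prime_idealE (J : ideal R) : prime_ideal J <-> is_prime (inI J).
Proof.
split=> [[J1 Jp]|[_ J1 Jp]]; split.
- exact: is_id_mem.
- exact/negP.
- by move=> a b /Jp/orP[]; [left | right].
- exact/negP.
- by move=> u v /Jp[uJ|vJ]; apply/orP; [left | right].
Qed.

Lemma prime_chain_chain n (c : nat -> ideal R) :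
  prime_chain n c -> chain n (inI (c 0%N)) (inI (c n)).
Proof.
elim: n c => [|n IH] c [cp cs]; first by split=> //; apply/prime_idealE/cp.
split; first exact/prime_idealE/cp.
have [s01 n01] := cs 0%N isT; exists (inI (c 1%N)); split.
- exact: s01.
- by move=> h; apply: n01 => x; apply: h.
- by apply: (IH (fun i => c i.+1)); split=> i ilt; [apply: cp | apply: cs].
Qed.

Lemma ideal_of P : is_id P -> exists J : ideal R, inI J = P.
Proof.
move=> hP; have [J JE] := sub_exists (hP : is_sub (P : R^o -> Prop)).
by exists J; apply/funext => x; rewrite /inI JE; apply/propext; split=> /asboolP.
Qed.

Lemma chain_prime_chain n P Q : chain n P Q ->
  exists c : nat -> ideal R, [/\ prime_chain n c, inI (c 0%N) = P & inI (c n) = Q].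
Proof.
elim: n P => [|n IH] P [pP].
  move=> <-; have [J JP] : exists J : ideal R, inI J = P by apply: ideal_of; case: pP.
  by exists (fun=> J); split=> //; split=> // i _; apply/prime_idealE; rewrite JP.
move=> [P' [PP' P'P /IH[c [[cp cs] c0 cn]]]].
have [J JP] : exists J : ideal R, inI J = P by apply: ideal_of; case: pP.
exists (fun i => if i is j.+1 then c j else J); split=> //; split.
  by case=> [|i] ilt; [apply/prime_idealE; rewrite JP | apply: cp].
case=> [|i] ilt; last exact: cs.
split=> [x|h]; first by move: (PP' x); rewrite -JP -c0.
by apply: P'P => x; rewrite -JP -c0; apply: h.
Qed.

Lemma height_geP (I : ideal R) d : height_ge I d <->
  forall P, is_prime P -> (forall a : R, a \in I -> P a) -> exists P0, chain d P0 P.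
Proof.
split=> [h P pP IP|h P /prime_idealE pP IP].
  have [J JP] : exists J : ideal R, inI J = P by apply: ideal_of; case: pP.
  have [||c cc cJ] := h J.
  - by apply/prime_idealE; rewrite JP.
  - by move=> x /IP; rewrite -JP.
  exists (inI (c 0%N)); have -> : P = inI (c d); last exact: prime_chain_chain.
  by rewrite -JP; apply/funext => x; rewrite /inI cJ.
have [|P0 /chain_prime_chain[c [cc _ cP]]] := h _ pP; first exact: IP.
exists c => // x; have := congr1 (fun S => S x) cP; rewrite /inI => e.
by apply/idP/idP; rewrite e.
Qed.

(** [noeth_max] supplies a maximal ideal over each proper ideal, and uniqueness identifies it with
    [m]. *)
Lemma local_ring_facts (m : ideal R) : local_ring m ->
  [/\ is_prime (inI m), forall t : R, t \notin m -> exists u : R, u * t = 1 &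
    forall J, is_id J -> ~ J 1 -> forall a, J a -> a \in m].
Proof.
move=> [noethR [m1 mmax] muniq].
have Jm J : is_id J -> ~ J 1 -> forall a, J a -> a \in m.
  move=> hJ J1.
  have [|A [hA [JA A1] Amax]] := noeth_max noethR (Phi := fun A =>
      (forall a, J a -> A a) /\ ~ A 1); first by exists J.
  have [K KA] := ideal_of hA.
  have KE (x : R) : (x \in K) <-> A x by rewrite -KA.
  have /muniq Km : maximal_ideal K.
    split; first by apply/negP => /KE.
    move=> K' K'1 KK' x xK'; apply/KE; apply: (Amax (inI K')) => //.
    - exact: is_id_mem.
    - split; last exact/negP.
      by move=> a /JA/KE; apply: KK'.
    - by move=> a /KE; apply: KK'.
  by move=> a /JA/KE; rewrite Km.
have mu (t : R) : t \notin m -> exists u : R, u * t = 1.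
  move=> tm; apply: contrapT => nou.
  have h0 : is_id (idadd (fun a => a = 0) t) by apply/idadd_id/zero_id.
  move/negP: tm; apply; apply: (Jm _ h0); last exact: (idadd_mem _ (zero_id R)).
  move=> [r /eqP]; rewrite subr_eq0 => /eqP r1; apply: nou; exists r.
  by rewrite -r1.
split=> //; split; [exact: is_id_mem | exact/negP |].
move=> a b abm; apply: contrapT => /not_orP[/negP/mu[u ua] /negP/mu[v vb]].
move/negP: m1; apply.
have -> : (1 : R) = (u * v) * (a * b) by rewrite mulrACA ua vb mulr1.
exact: (is_idMl _ (is_id_mem m)).
Qed.

Lemma regular_local_facts (m : ideal R) : regular_local_ring m ->
  exists s : seq R, [/\ regs (fun a => a = 0) s, is_prime (fun a : R => a = 0),
    forall a, adds (fun a => a = 0) s a <-> a \in m &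
    forall P Q, ~ chain (size s).+1 P Q].
Proof.
move=> [lr [s sg [[c cc] dimn]]]; have [noethR _ _] := lr.
have [pm mu Jm] := local_ring_facts lr.
have nochain P Q : ~ chain (size s).+1 P Q.
  by move=> /chain_prime_chain[c' [? _ _]]; apply: dimn; exists c'.
pose t : seq R := [seq incl m x | x <- s].
have tm : adds (fun a => a = 0) t = inI m.
  apply/funext => a; apply/propext; split.
    apply: adds_min; first exact: is_id_mem.
      by move=> b ->; case: (is_id_mem m).
    by move=> y /mapP[x _ ->]; apply: incl_mem.
  move=> am; have [x xa] := @incl_onto _ _ m a am.
  have [k xk] := sg x; rewrite -xa xk linear_sum.
  have hA : is_sub (adds (fun a => a = 0) t : R^o -> Prop) by apply: (adds_id t (zero_id R)).
  apply: (is_sub_sum _ hA) => i _; rewrite linearZ; apply: (is_subZ _ hA).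
  by apply: adds_mem; [exact: zero_id | apply/map_f/mem_nth].
have c1 := prime_chain_chain cc.
have pc := chain_last c1.
(* A chain of maximal length ends at [m], since [m] could otherwise be appended. *)
have cm : inI (c (size s)) = inI m.
  apply: contrapT => ne.
  have cm a : inI (c (size s)) a -> inI m a.
    by apply: Jm; [case: pc | case: pc].
  apply: (nochain (inI (c 0%N)) (inI m)); rewrite -addn1; apply: chain_cat c1 _.
  split=> //; exists (inI m); split=> // h; apply: ne; apply/funext => a.
  by apply/propext; split; [apply: cm | apply: h].
have ts : size t = size s by rewrite size_map.
rewrite cm -ts in c1; have [] := @regular_domain R (inI m) noethR pm _ _ _ _ (zero_id R) tm _ c1.
- by move=> u /negP; apply: mu.
- by move=> a ->; case: (chain_prime c1) => -[].
move=> p0 rt; exists t; split=> //; first by move=> a; rewrite tm.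
by rewrite ts.
Qed.

Lemma adds_lspanE (s : seq R) a : adds (fun a => a = 0) s a <-> lspan (s : seq R^o) a.
Proof.
split.
  apply: adds_min; first exact: (lspan_sub (s : seq R^o)).
    by move=> b ->; case: (lspan_sub (s : seq R^o)).
  by move=> y ys; apply: lspan_mem.
apply: (@lspan_min R R^o) => [|y ys]; first exact: (adds_id s (zero_id R)).
by apply: adds_mem => //; apply: zero_id.
Qed.

Lemma regular_sequence_regs (s : seq R^o) : regular_sequence s -> regs (fun a : R => a = 0) s.
Proof.
move=> [H _].
have {}H i : (i < size s)%N -> nzd (adds (fun a : R => a = 0) (take i s)) (s`_i).
  by move=> ilt x /adds_lspanE/in_spanE/(H i ilt)/in_spanE/adds_lspanE.
elim/last_ind: s H => // s x IH H; apply/regs_rcons; split.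
  apply: IH => i ilt; have := H i; rewrite size_rcons nth_rcons ilt -cats1.
  by rewrite take_cat ilt => h; apply: h; apply: ltnW.
have := H (size s); rewrite size_rcons nth_rcons ltnn eqxx -cats1.
by rewrite take_size_cat // => h; apply: h.
Qed.

Lemma quot_vect_fg (V : vectType R) (S : submodClosed V) : finitely_generated (quotmod S).
Proof.
have [p [ps _]] := quot_pi S.
exists [seq p (r2v (delta_mx 0 k)) | k : 'I_(dim V)] => y; have [u <-] := ps y.
apply/in_spanE; rewrite [u]vect_basisE linear_sum.
apply: (is_sub_sum _ (lspan_sub _)) => k _; rewrite linearZ.
by apply: (is_subZ _ (lspan_sub _)); apply: lspan_mem; apply: image_f.
Qed.

End RegularLocal.

(** * Splitting off the free summand *)

Section Assembly.
Variables (R : comNzRingType) (m I : ideal R) (Omega : lmodType R).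
Variables (F : free_resolution (quotmod I)) (L : free_resolution Omega).
Hypothesis noethR : noetherian R.
Hypothesis pm : is_prime (inI m).
Hypothesis mu : forall t : R, t \notin m -> exists u : R, u * t = 1.
Hypothesis Im : {subset I <= m}.
Let zero := fun a : R => a = 0.

Lemma aug_lift : exists (lam : {linear 'rV[R]_(rk F 0) -> R^o}) e,
  [/\ 1 - lam e \in I, (forall u, lam (bd F 0 u) \in I) &
    forall v, lam v \in I -> aug F v = 0].
Proof.
have [p [ps pI]] := quot_pi I.
have [|lam lamE] := lift_free (g := p) (f := aug F).
  by move=> v; have [w wv] := ps (aug F v); exists w.
have [e eE] := aug_onto F (p 1); exists lam, e; split.
- by apply/pI; rewrite linearB lamE eE subrr.
- by move=> u; apply/pI; rewrite lamE augbd.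
- by move=> v /pI; rewrite lamE.
Qed.

(** With $I=0$, [lam] is itself a 0-cocycle and takes the value 1 at [e]. Evaluation at [e] descends
    to $\Omega$ because 0-coboundaries are zero. *)
Lemma free_summand_height0 : (forall a : R, a \in I -> a = 0) ->
  lmod_iso Omega (ext F 0) -> has_free_summand Omega.
Proof.
move=> I0 /ext_presentation[p [ps pK]].
have [lam [e [lame lambd _]]] := aug_lift.
have [|ze zeE] := linear_fun (f := fun z => ev (incl (cocycles F 0) z) e : R^o).
  by move=> a u v; rewrite linearP evP.
have [||chi chiE] := factor_surj (f := p) (k := ze); first exact: ps.
  by move=> z /pK z0; rewrite zeE [incl _ _]z0 ev0.
have [|z zE] := @cocycleI _ _ F 0 (mkdual lam).
  by move=> x; rewrite ev_mkdual; apply: I0.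
apply: (free_summand_of_functional (chi := chi) (x := p z)).
rewrite chiE zeE zE ev_mkdual; apply/eqP; rewrite eq_sym -subr_eq0; apply/eqP.
exact: I0.
Qed.

Lemma free_summand_pos e s y :
  regs zero s -> (forall a, adds zero s a <-> a \in m) ->
  order_ideal_conjecture m -> lmod_iso Omega (ext F e.+1) ->
  size y = e.+1 -> (forall x : R, x \in y -> x \in I) -> regs zero y ->
  ~ ext_vanishes F zero e.+1 ->
  has_free_summand (syz L e.+1).
Proof.
move=> rs sm oic iso ys yI ry nvan.
have kI (x : R) (v : quotmod I) : x \in I -> x *: v = 0.
  move=> xI; have [p [ps pI]] := quot_pi I; have [w <-] := ps v.
  by rewrite -linearZ; apply/pI; apply: (is_idMr w (is_id_mem I)).
have kO (x : R) (w : Omega) : x \in I -> x *: w = 0.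
  by move=> xI; apply: (ext_killed iso) => v; apply: kI.
have vanF i : (i < e.+1)%N -> ext_vanishes F zero i.
  by rewrite -ys; apply: ext_regs ry _ => //; [exact: zero_id | move=> x /yI xI v; apply: kI].
have vanL i : (i < e.+1)%N -> ext_vanishes L zero i.
  by rewrite -ys; apply: ext_regs ry _ => //; [exact: zero_id | move=> x /yI xI v; apply: kO].
have [dl dlE] := dual_bd_exists F.
have [Z [i [p [th [WZ [iI ps ip] thE retr]]]]] :=
  @dual_syzygy _ _ _ _ _ dl dlE e.+1 iso vanF vanL e 0%N erefl.
have nO : ~ forall w : Omega, w = 0.
  move=> O0; apply: nvan => phi phi0.
  have [q [qs qK]] := ext_presentation iso.
  have [|z zE] := @cocycleI _ _ F e.+1 (mkdual phi).
    by move=> x; rewrite ev_mkdual; apply: phi0.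
  have [psi psiE] := (qK z).1 (O0 _).
  rewrite zE in psiE; exists (ev (psi : dual R _)) => u; apply/eqP; rewrite subr_eq0.
  by apply/eqP; rewrite -ev_mkdual; apply: psiE.
have [lam [e0 [lame lambd lam0]]] := aug_lift.
have [f0 [f0s f0E]] := im_corestrict (dl 0).
(* $\operatorname{Hom}(R/I,R)=0$ makes $D_0\to D_1$ injective, so its image is a copy of $D_0$;
   [del] is the inverse identification. *)
have f0i : injective f0.
  move=> u v /(congr1 (incl (im_lin (dl 0)))); rewrite !f0E.
  exact: (dl0_inj dlE (vanF 0%N isT)).
have [|del delE] := lift_mono f0i (f := lid _); first by move=> b; apply: f0s.
have [g [gs gE]] := syz_cover L e.
have [|h hE] := lift_free (g := p) (f := g); first by move=> v; apply: ps.
have [|hK hKE] := lift_mono iI (f := lcomp h (syz_incl L e)).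
  by move=> x; apply/ip; rewrite /= hE; apply/gE; exists x.
have [|chi chiE] := linear_fun (f := fun x => ev (del (hK x)) e0 : R^o).
  by move=> a u v; rewrite !linearP evP.
have [[x xm]|nox] := pselect (exists x, chi x \notin m).
  have [u ux] := mu xm.
  by apply: (free_summand_of_functional (chi := chi) (x := u *: x)); rewrite linearZ.
exfalso.
have chim x : chi x \in m by apply: contraT => xm; case: nox; exists x.
have hm := is_id_mem m.
pose b := i (f0 (mkdual lam)).
(* Otherwise chi, read modulo m, would produce lam(e0) in m. *)
have bm : ~ in_mN m b.
  move=> /(_ (fun z => exists mu0 l, z = i (f0 mu0) + h l /\ ev mu0 e0 \in m)) [].
  - split; first by exists 0, 0; rewrite !linear0 addr0 ev0; split=> //; case: hm.
    move=> a _ _ [mu1 [l1 [-> m1]]] [mu2 [l2 [-> m2]]].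
    exists (a *: mu1 + mu2), (a *: l1 + l2); split.
      by rewrite !linearP scalerDr addrACA.
    by rewrite evP; apply: (is_idD hm) => //; apply: (is_idMl _ hm).
  - move=> c z cm.
    have [l lz] := gs (p z).
    have [|bb bbE] := (ip (z - h l)).1; first by rewrite linearB hE lz subrr.
    exists (c *: del bb), (c *: l); split.
      by rewrite !linearZ /= delE bbE -scalerDr subrK.
    by rewrite evZ; apply: (is_idMr _ hm).
  move=> mu0 [l [bE mu0m]].
  have [|x xl] := (gE l).1.
    rewrite -hE -[h l](addKr (i (f0 mu0))) -bE linearD linearN.
    have pi0 b' : p (i b') = 0 by apply/ip; exists b'.
    by rewrite !pi0 oppr0 addr0.
  have : ev (del (hK x)) e0 = lam e0 - ev mu0 e0.
    have -> : hK x = f0 (mkdual lam - mu0).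
      by apply: iI; rewrite hKE /= xl !linearB -/b bE addrAC subrr add0r.
    have -> : del (f0 (mkdual lam - mu0)) = mkdual lam - mu0 by apply: f0i; rewrite delE.
    by rewrite evB ev_mkdual.
  rewrite -chiE => chixE.
  have [_ m1 _] := pm; apply: m1; rewrite /inI.
  have -> : (1 : R) = (1 - lam e0) + (chi x + ev mu0 e0) by rewrite chixE; ring.
  by apply: (is_idD hm); [apply: Im | apply: (is_idD hm)].
(* Modulo ker aug, lam f v and lam v f agree; this turns a functional psi on Z
   with psi b = a into a linear map Z -> B restricting to a on B. *)
have ann a : a \in order_ideal b -> forall w : Omega, a *: w = 0.
  move=> /asboolP[psi psib].
  have [f fE] := bidual (lcomp psi (lcomp i f0)).
  have af : a = lam f by rewrite -psib -[RHS]ev_mkdual -fE.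
  have lamZ c u : lam (c *: u) = c * lam u by rewrite linearZ.
  have [|lamf lamfE] := linear_fun (f := fun v => lam v *: f).
    by move=> c u v; rewrite linearP scalerDl -scalerA.
  have [|G GE] := lift_free (g := bd F 0)
      (f := lsub (lscale (lam f) (lid _)) lamf).
    move=> v; apply: aug_exact; apply: lam0.
    rewrite /= lamfE linearB !lamZ [X in X - _]mulrC subrr.
    by case: (is_id_mem I).
  (* On the image of [nu] the two terms are $\nu(f)\lambda$ and $\nu(\lambda(f)v-\lambda(v)f)$ as
     functions of $v$; their sum is $\lambda(f)\nu=a\nu$. *)
  have [|Psi PsiE] := linear_fun (f := fun z =>
      mkdual (ladd (lscale (psi z) lam) (lcomp (ev (th z)) G))).
    move=> c u v; apply: ev_inj => x; rewrite evP !ev_mkdual /= !linearP evP.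
    by rewrite /GRing.scale /= mulrDl mulrDr mulrA addrACA.
  apply: retr; exists (lcomp f0 Psi) => b0; have [nu <-] := f0s b0.
  rewrite -[LHS]/(f0 (Psi _)) -linearZ; congr (f0 _); apply: ev_inj => x.
  rewrite PsiE ev_mkdual evZ /= thE f0E dlE GE /= lamfE linearB.
  have -> : psi (i (f0 nu)) = ev nu f by rewrite -fE.
  have evZr c u : ev nu (c *: u) = c * ev nu u by rewrite linearZ.
  by rewrite !evZr af /GRing.scale /= [_ * lam x]mulrC addrC subrK.
have fgW := quot_vect_fg (im_lin (dl e.+1)).
have fpd := regular_finite_projdim noethR pm mu fgW rs sm.
(* The order of the syzygy [Z] is [e.+2], one above the height; this is what reaches Ext in degree
   [e.+1]. *)
have [b1|[t [ts tb rt]]] := order_ideal_nsyz noethR mu oic fgW fpd (ltn0Sn _) WZ bm.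
  by apply: nO => w; rewrite -[w]scale1r; apply: ann.
(* Now Ext^d(Omega, R) = 0, so that the extension Z splits and 1 kills Omega. *)
have vanL' : ext_vanishes L zero e.+1.
  apply: (ext_regs (zero_id R) _ (regular_sequence_regs rt)); last by rewrite ts.
  by move=> x /tb xb v; apply: ann.
have [T TE] := syz_extend vanL' (lcomp del hK).
(* [Z] is the pushout of $L_e$ and $D_0$ along $\operatorname{Syz}^d(\Omega)$; [T] and [del] agree
   there and glue to a retraction onto $D_0$. *)
have [|q qE] := linear_fun (f := fun x : 'rV[R]_(rk L e) * submod (im_lin (dl 0)) =>
    h x.1 + i x.2).
  by move=> a x x' /=; rewrite !linearP scalerDr addrACA.
have [|k kE] := linear_fun (f := fun x : 'rV[R]_(rk L e) * submod (im_lin (dl 0)) =>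
    T x.1 + del x.2).
  by move=> a x x' /=; rewrite !linearP scalerDr addrACA.
have [||Psi PsiE] := factor_surj (f := q) (k := k).
- move=> z; have [l lz] := gs (p z).
  have [|bb bbE] := (ip (z - h l)).1; first by rewrite linearB hE lz subrr.
  by exists (l, bb); rewrite qE /= bbE addrC subrK.
- move=> [l bb]; rewrite qE kE /= => /eqP; rewrite addr_eq0 => /eqP hl.
  have [|x xl] := (gE l).1.
    by rewrite -hE hl linearN; have -> : p (i bb) = 0; [apply/ip; exists bb | rewrite oppr0].
  have hKx : hK x = - bb by apply: iI; rewrite hKE /= xl hl linearN.
  by rewrite -xl TE /= hKx linearN addNr.
apply: nO => w; rewrite -[w]scale1r; apply: retr; exists (lcomp f0 Psi) => bb.
have <- : q (0, bb) = i bb by rewrite qE /= linear0 add0r.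
by rewrite -[LHS]/(f0 (Psi _)) PsiE kE /= linear0 add0r delE scale1r.
Qed.

End Assembly.

Theorem mainTheorem10 (R : comNzRingType) (m : ideal R)
  (Rreg : regular_local_ring m) (Roic : order_ideal_conjecture m)
  (I : ideal R) (d : nat) (Id : height I d)
  (Omega : lmodType R) (OmegaE : is_ext d (quotmod I) Omega)
  (F : free_resolution Omega) (Fmin : minimal m F) :
  has_free_summand (syz F d).
Proof.
have [s [rs p0 sm nochain]] := regular_local_facts Rreg.
have [lr _] := Rreg; have [noethR _ _] := lr.
have [pm mu Jm] := local_ring_facts lr.
have [/height_geP hge hlt] := Id; have [G iso] := OmegaE.
(* No prime contains the unit ideal, so [height_ge] holds for it in every degree, against [hlt]. *)
have Im : {subset I <= m}.
  move=> a; apply: (Jm (inI I)); first exact: is_id_mem.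
  move=> I1; apply: hlt; apply/height_geP => P [hP P1 _] IP.
  by case: P1; apply: IP.
(* In height 0 a nonzero element of [I] would place the prime (0) strictly below every prime over
   [I], making the height at least 1. *)
case: d Id OmegaE hge hlt iso => [|e] _ _ hge hlt iso.
  apply: (free_summand_height0 (F := G)) iso => a Ia; apply: contrapT => a0.
  apply: hlt; apply/height_geP => P pP IP; exists (fun a => a = 0).
  split=> //; exists P; split=> //; first by move=> x ->; case: pP => -[].
  by move=> h; apply: a0; apply: h; apply: IP.
have fgk : finitely_generated (quotmod m).
  have [p [ps _]] := quot_pi m; exists [:: p 1] => y; have [x <-] := ps y.
  by apply/in_spanE; exists x; rewrite -linearZ /GRing.scale /= mulr1 subrr.
have [K _] := minimal_resolution_exists noethR mu fgk.
have [y [ys yI ry]] := height_grade noethR pm mu K rs (fun x xs => (sm x).1 (adds_mem (zero_id R) xs))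
  nochain Im hge.
apply: (free_summand_pos F noethR pm mu Im rs sm Roic iso ys yI ry) => van.
apply: hlt; apply/height_geP; apply: (grade_height noethR (F := G) ys yI ry) => i.
rewrite leq_eqVlt => /orP[/eqP->//|]; rewrite -{1}ys; apply: ext_regs ry i.
  exact: zero_id.
move=> x /yI xI v; have [p [ps pI]] := quot_pi I; have [w <-] := ps v.
by rewrite -linearZ; apply/pI; apply: (is_idMr w (is_id_mem I)).
Qed.
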